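(* Let $\mu>0$ and let $X_1,X_2,\dots$ be i.i.d. Rayleigh random variables with second moment $\mu$; put $\widehat{\mu}_N=\frac1N\sum_{i=1}^N X_i^2$. For $\varepsilon,\delta\in(0,1)$ define $$\underline{N}(\varepsilon,\delta)=\min\left\{N>0:\ \Pr\left\{\left|\frac{\widehat{\mu}_N-\mu}{\mu}\right|<\varepsilon\right\}\ge 1-\delta\right\},\qquad \overline{N}(\varepsilon,\delta)=\frac{2(3+2\varepsilon)\ln\frac2\delta}{3\varepsilon^2},$$ where the minimum is over positive integers $N$, and let $Z_\delta$ be defined by $\frac{1}{\sqrt{2\pi}}\int_{-\infty}^{Z_\delta}e^{-x^2/2}\,dx=1-\frac{\delta}{2}$. Then for each $\mu>0$, $$\lim_{\delta\to0}\lim_{\varepsilon\to0}\frac{\overline{N}(\varepsilon,\delta)}{\underline{N}(\varepsilon,\delta)}=\lim_{\delta\to0}\frac{2\ln\frac2\delta}{Z_\delta^2}=1 .$$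
   Context: A Rayleigh random variable with second moment $\mu>0$ is a real random variable with density $f(x)=\frac{2x}{\mu}e^{-x^2/\mu}$ for $x\ge 0$ and $f(x)=0$ for $x<0$. *)

(* Defs.v *)
From HB Require Import structures.
From mathcomp Require Import all_boot all_order all_algebra finmap.
From mathcomp Require Import all_classical all_reals all_analysis.

Set Implicit Arguments.
Unset Strict Implicit.
Unset Printing Implicit Defensive.

Import Order.TTheory GRing.Theory Num.Theory.
Import numFieldNormedType.Exports.

Local Open Scope classical_set_scope.
Local Open Scope ring_scope.

Definition rayleigh_pdf (R : realType) (mu : R) (x : R) : R :=
  if 0 <= x then 2 * x / mu * expR (- x ^+ 2 / mu) else 0.

Definition has_density d (T : measurableType d) (R : realType)
    (P : probability T R) (X : {RV P >-> R}) (f : R -> R) : Prop :=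
  forall B : set R, measurable B ->
    distribution P X B = (\int[lebesgue_measure]_(x in B) (f x)%:E)%E.

Definition mutually_independent d (T : measurableType d) (R : realType)
    (P : probability T R) (X : nat -> {RV P >-> R}) : Prop :=
  forall (J : {fset nat}) (B : nat -> set R),
    (forall i, measurable (B i)) ->
    P (\bigcap_(i in [set` J]) (X i @^-1` B i)) =
    (\prod_(i <- J) P (X i @^-1` B i))%E.

(* The sequence is indexed from 0: the mean of the first N variables is taken
   over X 0, ..., X (N - 1). *)
Definition mu_hat d (T : measurableType d) (R : realType)
    (P : probability T R) (X : nat -> {RV P >-> R}) (N : nat) (w : T) : R :=
  N%:R^-1 * \sum_(i < N) X i w ^+ 2.

Definition admissible_size d (T : measurableType d) (R : realType)
    (P : probability T R) (X : nat -> {RV P >-> R}) (mu eps delta : R)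
    : set nat :=
  [set N | (0 < N)%N /\
    ((1 - delta)%:E <= P [set w | `|(mu_hat X N w - mu) / mu| < eps]%R)%E].

Definition is_min_nat (A : set nat) (n : nat) : Prop :=
  A n /\ forall m, A m -> (n <= m)%N.

(* The minimum; the default value 0 is taken only if no N is admissible. *)
Definition N_under d (T : measurableType d) (R : realType)
    (P : probability T R) (X : nat -> {RV P >-> R}) (mu eps delta : R) : nat :=
  xget 0%N (is_min_nat (admissible_size X mu eps delta)).

Definition N_over (R : realType) (eps delta : R) : R :=
  2 * (3 + 2 * eps) * ln (2 / delta) / (3 * eps ^+ 2).

(* The solution z of the displayed equation, unique when it exists because the
   left-hand side is strictly increasing; it exists for 0 < delta < 2, and the
   default value 0 is used for other delta. *)
Definition Z_quantile (R : realType) (delta : R) : R :=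
  xget 0 [set z : R |
    (Num.sqrt (2 * pi))^-1 *
      (\int[lebesgue_measure]_(x in `]-oo, z]) expR (- x ^+ 2 / 2))
    = 1 - delta / 2].

(* Main.v *)
(* The variables X_i ^ 2 / mu are independent standard exponentials, so the tail
   of the sum S_N of the first N of them is the Erlang tail, the sum over k < N
   of x ^ k / k! * exp (- x). The density of (S_N - N) / sqrt N is explicit:
   elementary bounds on ln (1 + u) give its pointwise convergence to the normal
   density and an integrable majorant, and dominated convergence gives the
   central limit theorem P(|S_N - N| <= z sqrt N) --> P(|G| <= z). Comparing
   eps sqrt N with a fixed z close to Z_delta yields eps ^ 2 * N_under -->
   Z_delta ^ 2; the sizes N below a fixed bound, which the limit theorem does
   not cover, are excluded because the Erlang tails are 1-Lipschitz. The limit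
   in delta follows from the normal tail being exp (- z ^ 2 / 2 + O(z)). *)
From HB Require Import structures.
Require Import Defs.
From mathcomp Require Import all_boot all_order all_algebra finmap.
From mathcomp Require Import all_classical all_reals all_analysis measurable_realfun.
From mathcomp Require Import ring lra.

Set Implicit Arguments.
Unset Strict Implicit.
Unset Printing Implicit Defensive.

Import Order.TTheory GRing.Theory Num.Theory.
Import numFieldNormedType.Exports.

Local Open Scope classical_set_scope.
Local Open Scope ring_scope.

(** Densities are given as identities on Borel sets and independence as a product formula for finite
    families of events, so the law of [S_N] has to be built from these. The obstacle in the limit
    [eps --> 0] is that the half-width [eps * sqrt N], measured in standard deviations, moves
    together with [N]. Fixing [z] and comparing nested windows avoids any uniformity: pointwise
    convergence at a single [z] is enough. Nor is the coverage probability shown to be monotone in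
    [N], so the two bounds on [N_under] differ in nature: for a fixed [v < Z_delta ^ 2], the lower
    one excludes every [N] with [eps ^ 2 * N < v]; for a fixed [v > Z_delta ^ 2], the upper one
    exhibits one admissible [N] with [eps ^ 2 * N] just above [v]. In both cases [z = sqrt v], and
    strict decrease of the normal tail puts the limiting coverage strictly on the right side of
    [1 - delta]. *)

(** * Integration against a measure with a density *)

Section integral_density.
Local Open Scope ereal_scope.
Import HBNNSimple.

(** For the indicator of a level set this is the hypothesis on [m]; linearity gives simple
    functions, and monotone convergence along an increasing approximation of [g] passes to the limit
    on both sides. *)
Lemma ge0_integral_density (R : realType) (m : {measure set R -> \bar R})
    (f : R -> R) (g : R -> \bar R) :
  measurable_fun setT f -> (forall x, (0 <= f x)%R) ->
  (forall B, measurable B ->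
    m B = \int[lebesgue_measure]_(x in B) (f x)%:E) ->
  measurable_fun setT g -> (forall x, 0 <= g x) ->
  \int[m]_x g x = \int[lebesgue_measure]_x (g x * (f x)%:E).
Proof.
move=> mf f0 mE mg g0.
pose h := nnsfun_approx measurableT mg.
have hg x : EFin \o h ^~ x @ \oo --> g x by exact: cvg_nnsfun_approx.
have mh n : measurable_fun setT (h n : R -> R) by exact: measurable_funPT.
have nd_h x : {homo (fun n => h n x) : a b / (a <= b)%N >-> (a <= b)%R}.
  by move=> a b ab; exact/lefP/nd_nnsfun_approx.
transitivity (limn (fun n => \int[m]_x (h n x)%:E)).
  rewrite -monotone_convergence//.
  - by apply: eq_integral => x _; apply/esym/cvg_lim => //; exact: hg.
  - by move=> n; exact/measurable_EFinP/measurable_funPT.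
  - by move=> n x _; rewrite lee_fin.
  - by move=> x _ a b ab; rewrite lee_fin; exact: nd_h.
transitivity (limn (fun n => \int[lebesgue_measure]_x ((h n x)%:E * (f x)%:E))); last first.
  rewrite -monotone_convergence//.
  - apply: eq_integral => x _; apply/cvg_lim => //.
    by apply: cvgeZr => //; exact: hg.
  - move=> n; apply: emeasurable_funM; last exact/measurable_EFinP.
    by apply/measurable_EFinP; exact: mh.
  - by move=> n x _; rewrite mule_ge0// lee_fin.
  - by move=> x _ a b ab; rewrite lee_wpmul2r ?lee_fin//; exact: nd_h.
congr (limn _); apply/funext => n.
have mfib y : measurable (h n @^-1` [set y]) by exact: measurable_funPTI.
have mind y : measurable_fun setT (fun x => (y * \1_(h n @^-1` [set y]) x)%:E).
  by apply/measurable_EFinP; exact: measurable_funM.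
transitivity (\int[m]_x \sum_(y \in range (h n))
    (y * \1_(h n @^-1` [set y]) x)%:E).
  by apply: eq_integral => x _; rewrite fimfunE -fsumEFin.
rewrite ge0_integral_fsum//; last by move=> y x _; exact: nnfun_muleindic_ge0.
transitivity (\int[lebesgue_measure]_x \sum_(y \in range (h n))
    ((y * \1_(h n @^-1` [set y]) x)%:E * (f x)%:E)); last first.
  apply: eq_integral => x _; rewrite -ge0_mule_fsuml; last first.
    by move=> y; exact: nnfun_muleindic_ge0.
  by rewrite fsumEFin// -fimfunE.
rewrite ge0_integral_fsum//; last 2 first.
- by move=> y; apply: emeasurable_funM; [exact: mind|exact/measurable_EFinP].
- move=> y x _; apply: mule_ge0; first by rewrite EFinM; exact: nnfun_muleindic_ge0.
  by rewrite lee_fin.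
apply: eq_fsbigr => y /[!inE] -[x0 _ <-].
rewrite integralZl_indic_nnsfun// integral_indic// setIT mE//.
under [RHS]eq_integral do rewrite EFinM -muleA.
rewrite ge0_integralZl//.
- congr (_ * _); rewrite [LHS]integral_mkcond.
  apply: eq_integral => x _.
  by rewrite epatch_indic muleC.
- apply: emeasurable_funM; last exact/measurable_EFinP.
  have mi : measurable_fun setT (\1_(h n @^-1` [set h n x0]) : R -> R).
    exact: measurable_indic.
  by apply/measurable_EFinP; exact: mi.
- by move=> x _; rewrite mule_ge0// lee_fin.
- by rewrite lee_fin.
Qed.

End integral_density.

(** * Independence of a partial sum from the later variables *)

Lemma mutually_independent_tail d (T : measurableType d) (R : realType)
    (P : probability T R) (X : nat -> {RV P >-> R}) (f : R -> R)
    (B : nat -> set R) :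
  mutually_independent X -> (forall i, measurable (B i)) -> forall k n,
  P (\bigcap_(i in [set i | (k <= i < k + n)%N]) (X i @^-1` B i)) =
  (\prod_(k <= i < k + n) P (X i @^-1` B i))%E.
Proof.
move=> iX mB k n.
have := iX [fset i in index_iota k (k + n)]%fset B mB.
rewrite (_ : [set` _] = [set i | (k <= i < k + n)%N]); last first.
  by apply/seteqP; split => i /=; rewrite !inE mem_index_iota.
move=> ->; apply/perm_big/uniq_perm; rewrite ?fset_uniq ?iota_uniq//.
by move=> i; rewrite !inE.
Qed.


(* [E] only depends on the variables of index at least [k]. *)
Definition tail_event d (T : measurableType d) (R : realType)
    (P : probability T R) (X : nat -> {RV P >-> R}) (k : nat) (E : set T) :=
  exists n (B : nat -> set R), (forall i, measurable (B i)) /\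
    E = \bigcap_(i in [set i | (k <= i < k + n)%N]) (X i @^-1` B i).

Section tail_events.
Context d (T : measurableType d) (R : realType) (P : probability T R).
Variable X : nat -> {RV P >-> R}.
Hypothesis iX : mutually_independent X.

Lemma tail_event_setT k : tail_event X k setT.
Proof.
exists 0%N, (fun=> setT); split => //.
by apply/seteqP; split => // w _ i /= _.
Qed.

Lemma tail_event_measurable k E : tail_event X k E -> measurable E.
Proof.
move=> [n [B [mB ->]]]; apply: bigcap_measurableType => i _.
exact: measurable_funPTI.
Qed.

(** Overwriting [B] at index [k] by [A] makes the intersection a rectangle over one more consecutive
    index, and the product formula splits off its first factor. *)
Lemma tail_eventS k A E : measurable A -> tail_event X k.+1 E ->
  tail_event X k (X k @^-1` A `&` E) /\
  P (X k @^-1` A `&` E) = (P (X k @^-1` A) * P E)%E.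
Proof.
move=> mA [n [B [mB ->]]].
pose B' i := if i == k then A else B i.
have mB' i : measurable (B' i) by rewrite /B'; case: ifP.
have B'E i : (k < i)%N -> B' i = B i.
  by rewrite /B' ltn_neqAle eq_sym => /andP[/negPf->].
have capE : X k @^-1` A `&` \bigcap_(i in [set i | (k.+1 <= i < k.+1 + n)%N])
      (X i @^-1` B i) =
    \bigcap_(i in [set i | (k <= i < k + n.+1)%N]) (X i @^-1` B' i).
  apply/seteqP; split => [w [Aw Bw] i /= /andP[ki ikn]|w Bw].
    move: ki; rewrite leq_eqVlt => /predU1P[<-|ki]; first by rewrite /B' eqxx.
    by rewrite B'E//; apply: Bw => /=; rewrite ki addSnnS.
  split => [|i /= /andP[ki ikn]].
    have /= := Bw k; rewrite /B' eqxx; apply.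
    by rewrite leqnn addnS ltnS leq_addr.
  by rewrite -(B'E i ki); apply: Bw; rewrite /= (ltnW ki) -addSnnS.
split; first by exists n.+1, B'.
rewrite capE !mutually_independent_tail// addSnnS big_ltn; last first.
  by rewrite addnS ltnS leq_addr.
rewrite {1}/B' eqxx; congr (_ * _)%E.
by apply: eq_big_nat => i /andP[ki _]; rewrite B'E.
Qed.

End tail_events.

Section independent_pair.
Context d (T : measurableType d) (R : realType) (P : probability T R).
Variables (U V : {RV P >-> R}) (E : set T).
Hypothesis mE : measurable E.

Let nu : set R -> \bar R := pushforward (mrestr P mE) U.

Let nu0 : nu set0 = 0%E.
Proof. exact: measure0. Qed.

Let nu_ge0 A : (0 <= nu A)%E.
Proof. exact: measure_ge0. Qed.

Let nu_sigma_additive : semi_sigma_additive nu.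
Proof.
exact: measure_semi_sigma_additive.
Qed.

HB.instance Definition _ := isMeasure.Build _ _ _ nu
  nu0 nu_ge0 nu_sigma_additive.

Let nu_finite : fin_num_fun nu.
Proof.
move=> A mA; rewrite /nu /pushforward; apply: fin_num_measure.
exact: measurable_funPTI.
Qed.

HB.instance Definition _ := @Measure_isFinite.Build _ _ _ nu nu_finite.

(** Under [P] restricted to [E], the law of [(V, U)] agrees on rectangles with the product of the
    law of [V] and [nu]. By uniqueness of the product measure they agree on [C], and the product
    measure of [C] is the integral of its sections. *)
Lemma independent_pair_integral :
  (forall A B, measurable A -> measurable B ->
    P (V @^-1` A `&` U @^-1` B `&` E) =
    (P (V @^-1` A) * P (U @^-1` B `&` E))%E) ->
  forall C : set (R * R), measurable C ->
  P ([set w | C (V w, U w)] `&` E) =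
  (\int[distribution P V]_v P (U @^-1` (xsection C v) `&` E))%E.
Proof.
move=> indep C mC.
have mVU : measurable_fun setT (fun w => (V w, U w)) by exact: measurable_fun_pair.
pose VU : {mfun T >-> (R * R)%type} := mfun_Sub (mem_set mVU).
transitivity (pushforward (mrestr P mE) VU C) => //.
rewrite -(@product_measure_unique _ _ _ _ _ (distribution P V) nu)//.
Qed.

End independent_pair.

Section independent_sums.
Context d (T : measurableType d) (R : realType) (P : probability T R).
Variables (X : nat -> {RV P >-> R}) (f : R -> R).
Hypothesis iX : mutually_independent X.
Hypothesis mf : measurable_fun setT f.

Definition partial_sum k w := \sum_(i < k) f (X i w).

Lemma measurable_partial_sum k : measurable_fun setT (partial_sum k).
Proof. by apply: measurable_sum => i; exact: measurableT_comp. Qed.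

Let C A := (fun vu : R * R => vu.2 + f vu.1) @^-1` A.

Let measurable_C A : measurable A -> measurable (C A).
Proof.
move=> mA; rewrite -[C A]setTI.
have : measurable_fun setT (fun vu : R * R => vu.2 + f vu.1).
  apply: measurable_funD; first exact: measurable_snd.
  by apply: measurableT_comp => //; exact: measurable_fst.
exact.
Qed.

(** Integrating over the value [v] of [X k] turns the event for [partial_sum k.+1] into a section
    event for [partial_sum k], from which the assumed independence detaches [E]. *)
Let partial_sum_step k :
  (forall A E, measurable A -> tail_event X k E ->
    P (partial_sum k @^-1` A `&` E) = (P (partial_sum k @^-1` A) * P E)%E) ->
  forall A E, measurable A -> tail_event X k.+1 E ->
  P (partial_sum k.+1 @^-1` A `&` E) =
  (\int[distribution P (X k)]_v
     (P (partial_sum k @^-1` xsection (C A) v) * P E))%E.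
Proof.
move=> IH A E mA tE.
pose S : {RV P >-> R} := mfun_Sub (mem_set (measurable_partial_sum k)).
have -> : partial_sum k.+1 @^-1` A = [set w | C A (X k w, S w)].
  by apply/seteqP; split => w; rewrite /C /partial_sum /= big_ord_recr.
rewrite (@independent_pair_integral _ _ _ _ _ _ E)//.
- apply: eq_integral => v _; have [tE' _] := tail_eventS iX measurableT tE.
  (* Leaving [X k] unconstrained shows that an event starting at [k.+1] also starts at [k]. *)
  rewrite preimage_setT setTI in tE'.
  by apply: IH => //; apply: measurable_xsection; exact: measurable_C.
- exact: tail_event_measurable tE.
- move=> B B' mB mB'; have [tE1 PE1] := tail_eventS iX mB tE.
  have [tE2 _] := tail_eventS iX measurableT tE.
  rewrite preimage_setT setTI in tE2.
  rewrite [X in P (X `&` _)]setIC -setIA [LHS]IH// PE1 [in RHS]IH//.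
  by rewrite muleCA.
- exact: measurable_C.
Qed.

(** Arbitrary tail events, rather than events of [X k] alone, make the induction go through, because
    the step joins an event of [X k] to [E]. The step with [E = setT] identifies the integral that
    remains. *)
Lemma partial_sum_independent k A E : measurable A -> tail_event X k E ->
  P (partial_sum k @^-1` A `&` E) = (P (partial_sum k @^-1` A) * P E)%E.
Proof.
elim: k A E => [|k IH] A E mA tE.
  have -> : partial_sum 0 @^-1` A = if 0 \in A then setT else set0.
    by apply/seteqP; split => w; rewrite /partial_sum /= big_ord0;
      case: ifPn => //; [move/negP; rewrite inE|rewrite inE].
  case: ifPn => _; first by rewrite setTI probability_setT mul1e.
  by rewrite set0I measure0 mul0e.
rewrite partial_sum_step//.
have := partial_sum_step IH mA (tail_event_setT X k.+1); rewrite setIT => ->.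
rewrite -ge0_integralZr//.
- by apply: eq_integral => v _; rewrite probability_setT mule1.
- apply: emeasurable_funM => //.
  pose S : {RV P >-> R} := mfun_Sub (mem_set (measurable_partial_sum k)).
  by apply: (@measurable_fun_xsection _ _ _ _ R (distribution P S));
    exact: measurable_C.
- by move=> v _; rewrite mule_ge0.
Qed.

Lemma measurable_partial_sum_section k A : measurable A ->
  measurable_fun setT (fun v => P [set w | A (partial_sum k w + f v)%R]).
Proof.
move=> mA; rewrite (_ : (fun _ => _) =
    fun v => distribution P (mfun_Sub (mem_set (measurable_partial_sum k)))
               (xsection (C A) v)); last first.
  apply/funext => v; congr (P _); apply/seteqP.
  by split => w /=; rewrite /xsection/= ?inE// => ?; rewrite inE.
by apply: measurable_fun_xsection; exact: measurable_C.
Qed.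

Lemma partial_sumS_probability k A : measurable A ->
  P (partial_sum k.+1 @^-1` A) =
  (\int[distribution P (X k)]_v P [set w | A (partial_sum k w + f v)%R])%E.
Proof.
move=> mA; rewrite -[X in P X]setIT.
rewrite (partial_sum_step (@partial_sum_independent k))//; last first.
  exact: tail_event_setT.
apply: eq_integral => v _; rewrite probability_setT mule1; congr (P _).
by apply/seteqP; split => w /=; rewrite /xsection/= ?inE// => ?; rewrite inE.
Qed.

End independent_sums.

(** * Derivatives of explicit expressions and the fundamental theorem of calculus *)

Section pointwise_derivatives.
Context (R : realType).
Implicit Types (f g : R -> R) (x : R).

Lemma is_derive_mul_fun f g x df dg :
  is_derive x 1 f df -> is_derive x 1 g dg ->
  is_derive x 1 (fun y => f y * g y) (f x * dg + g x * df).
Proof. by move=> ? ?; exact: is_deriveM. Qed.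

Lemma is_derive_exp_fun f n x df : is_derive x 1 f df ->
  is_derive x 1 (fun y => f y ^+ n) (n%:R * f x ^+ n.-1 * df).
Proof. by move=> ?; rewrite -exprfctE; exact: is_deriveX. Qed.

Lemma is_derive_expR_fun f x df : is_derive x 1 f df ->
  is_derive x 1 (fun y => expR (f y)) (expR (f x) * df).
Proof. by move=> ?; exact: is_derive1_comp. Qed.

End pointwise_derivatives.

Section fundamental_theorem.
Context (R : realType).
Implicit Types f F : R -> R.

Lemma is_derive_continuous F f :
  (forall x : R, is_derive x 1 F (f x)) -> continuous F.
Proof.
by move=> dF x; apply: differentiable_continuous; apply/derivable1_diffP.
Qed.

Lemma integral_is_derive F f a b : a <= b ->
  (forall x : R, is_derive x 1 F (f x)) -> continuous f ->
  (\int[lebesgue_measure]_(x in `[a, b]) (f x)%:E = (F b - F a)%:E)%E.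
Proof.
move=> ab dF cf; have cF := is_derive_continuous dF.
move: ab; rewrite le_eqVlt => /predU1P[->|ab].
  by rewrite set_itv1 integral_set1 subrr.
rewrite (@continuous_FTC2 _ f F)//.
- exact: continuous_subspaceT.
- split=> [x _| |]; first by [].
  + exact/cvg_at_right_filter/cF.
  + exact/cvg_at_left_filter/cF.
- by move=> x _; rewrite derive1E derive_val.
Qed.

Lemma integraly_is_derive F f a l :
  (forall x : R, is_derive x 1 F (f x)) -> continuous f ->
  (forall x, a <= x -> 0 <= f x) -> F x @[x --> +oo] --> l ->
  (\int[lebesgue_measure]_(x in `[a, +oo[) (f x)%:E = (l - F a)%:E)%E.
Proof.
move=> dF cf f0 Fl; have cF := is_derive_continuous dF.
rewrite (@ge0_continuous_FTC2y _ f F a l)//.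
- exact: continuous_subspaceT.
- by apply: cvg_at_right_filter; exact: cF.
- by move=> x _; rewrite derive1E derive_val.
Qed.

End fundamental_theorem.

(** * Erlang tails *)

(** For [x >= 0], the density of a sum of [n + 1] standard exponentials (the shape is [n + 1]), and
    also the Poisson weight of [n] at parameter [x]. *)
Definition gamma_pdf (R : realType) n (x : R) := x ^+ n / n`!%:R * expR (- x).

Definition erlang_tail (R : realType) n (x : R) := \sum_(k < n) gamma_pdf k x.

Section erlang_tail.
Context (R : realType).
Implicit Types x t : R.

Lemma gamma_pdf_ge0 n x : 0 <= x -> 0 <= gamma_pdf n x.
Proof. by move=> x0; rewrite !mulr_ge0// ?expR_ge0// exprn_ge0. Qed.

Lemma gamma_pdf_le1 n x : 0 <= x -> gamma_pdf n x <= 1.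
Proof.
move=> x0; rewrite /gamma_pdf expRN ler_pdivrMr ?expR_gt0// mul1r.
case: n => [|n]; first by rewrite expr0 divr1 -expR0 ler_expR.
by rewrite (le_trans _ (expR_ge1Dxn n x0))// lerDr.
Qed.

Lemma continuous_gamma_pdf n : continuous (@gamma_pdf R n).
Proof.
move=> x; rewrite /gamma_pdf; apply: cvgM; last first.
  apply: (cvg_comp _ expR); last exact: continuous_expR.
  by apply: cvgN; exact: cvg_id.
by apply: cvgM; [exact: exprn_continuous|exact: cvg_cst].
Qed.

Lemma is_derive_expRN x : is_derive x 1 (fun y => expR (- y)) (- expR (- x)).
Proof.
by apply: is_derive_eq (is_derive_expR_fun (is_deriveNid x 1)) _; rewrite mulrN1.
Qed.

Lemma is_derive_gamma_pdfS n x :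
  is_derive x 1 (gamma_pdf n.+1) (gamma_pdf n x - gamma_pdf n.+1 x).
Proof.
have dX := is_derive_exp_fun n.+1 (is_derive_id x 1).
have dXf := is_derive_mul_fun dX (is_derive_cst ((n.+1)`!%:R^-1 : R) x 1).
apply: is_derive_eq (is_derive_mul_fun dXf (is_derive_expRN x)) _.
rewrite /gamma_pdf /cst /= factS natrM exprS.
by field; rewrite addrC natr1 !pnatr_eq0 -lt0n fact_gt0.
Qed.

(** Each summand after the first has derivative [gamma_pdf k - gamma_pdf k.+1], so the sum
    telescopes to its last term. *)
Lemma is_derive_erlang_tail n x :
  is_derive x 1 (erlang_tail n.+1) (- gamma_pdf n x).
Proof.
elim: n => [|n IH].
  rewrite (_ : erlang_tail 1 = (fun y => expR (- y))); last first.
    by apply/funext => y; rewrite /erlang_tail big_ord1 /gamma_pdf divr1 mul1r.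
  by rewrite /gamma_pdf divr1 mul1r; exact: is_derive_expRN.
rewrite (_ : erlang_tail _ = erlang_tail n.+1 \+ gamma_pdf n.+1); last first.
  by apply/funext => y; rewrite /erlang_tail big_ord_recr.
have := is_derive_gamma_pdfS n x => ?.
by apply: is_derive_eq; rewrite addrA addNr add0r.
Qed.

Lemma erlang_tail0 n : erlang_tail n.+1 0 = 1 :> R.
Proof.
rewrite /erlang_tail big_ord_recl big1 ?addr0.
  by rewrite /gamma_pdf divr1 mul1r oppr0 expR0.
by move=> i _; rewrite /gamma_pdf expr0n /= !mul0r.
Qed.

Lemma cvg_erlang_tail n : erlang_tail n x @[x --> +oo] --> (0 : R).
Proof.
elim: n => [|k IH].
  by under eq_fun do rewrite /erlang_tail big_ord0; exact: cvg_cst.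
under eq_fun do rewrite /erlang_tail big_ord_recr/=.
suff : gamma_pdf k x @[x --> +oo] --> (0 : R).
  by move/(cvgD IH); rewrite addr0; apply.
(* The majorant comes from [gamma_pdf k x * x = k.+1 * gamma_pdf k.+1 x], whose last factor is at
   most 1. *)
apply: (@squeeze_cvgr _ _ _ _ (cst 0) (fun x => k.+1%:R * x^-1)).
- near=> x; have x0 : 0 < x by [].
  apply/andP; split; first exact/gamma_pdf_ge0/ltW.
  rewrite /= ler_pdivlMr//.
  rewrite (_ : _ * x = k.+1%:R * gamma_pdf k.+1 x).
    by rewrite ler_piMr// gamma_pdf_le1 ?ltW.
  rewrite /gamma_pdf factS natrM exprS.
  by field; rewrite addrC natr1 !pnatr_eq0 -lt0n fact_gt0.
- exact: cvg_cst.
- have : (x^-1 : R) @[x --> +oo] --> (0 : R).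
    by apply/gtr0_cvgV0; [exact: nbhs_pinfty_gt|exact: cvg_id].
  by move/(@cvgMl_tmp _ _ _ _ _ k.+1%:R); rewrite mulr0; apply.
Unshelve. all: by end_near.
Qed.

(** Mean value theorem with a density bounded by 1. The constant does not depend on [n], so one
    choice of [eps] serves finitely many sample sizes. *)
Lemma ler_erlang_tail n x y : 0 <= x -> x <= y ->
  erlang_tail n x - erlang_tail n y <= y - x.
Proof.
move=> x0 xy; case: n => [|n]; first by rewrite /erlang_tail !big_ord0; lra.
have [|c] := MVT_segment xy (fun z _ => is_derive_erlang_tail n z).
  exact/continuous_subspaceT/is_derive_continuous/is_derive_erlang_tail.
rewrite in_itv/= => /andP[xc cy] E.
have g1 : gamma_pdf n c <= 1 by apply/gamma_pdf_le1/(le_trans x0).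
have : gamma_pdf n c * (y - x) <= y - x by rewrite ler_piMl// subr_ge0.
by move: E; rewrite mulNr; lra.
Qed.

End erlang_tail.

(** * Law of the normalised sum of squared Rayleigh variables *)

Section rayleigh_sums.
Context d (T : measurableType d) (R : realType) (P : probability T R).
Variables (X : nat -> {RV P >-> R}) (mu : R).
Hypothesis mu_gt0 : 0 < mu.
Implicit Types t v x : R.

Let is_derive_rayleigh_survival x :
  is_derive x 1 (fun y => expR (- y ^+ 2 / mu))
    (- (2 * x / mu * expR (- x ^+ 2 / mu))).
Proof.
have dX := is_derive_exp_fun 2 (is_derive_id x 1).
have dXm := is_derive_mul_fun (is_deriveN dX) (is_derive_cst (mu^-1 : R) x 1).
apply: is_derive_eq (is_derive_expR_fun dXm) _.
by rewrite /cst /=; ring.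
Qed.

Lemma measurable_rayleigh_pdf : measurable_fun setT (rayleigh_pdf mu).
Proof.
rewrite (_ : rayleigh_pdf mu =
    fun x => 2 * Num.max 0 x / mu * expR (- x ^+ 2 / mu)); last first.
  by apply/funext => x; rewrite /rayleigh_pdf; case: ltP;
    rewrite ?mulr0 ?mul0r.
apply: measurable_funM.
  apply: measurable_funM => //; apply: measurable_funM => //.
  exact: measurable_maxr.
apply: measurableT_comp => //; apply: measurable_funM => //.
by apply: measurableT_comp => //; exact: measurable_funX.
Qed.

Lemma rayleigh_pdf_ge0 x : 0 <= rayleigh_pdf mu x.
Proof.
rewrite /rayleigh_pdf; case: ifP => // x0.
by rewrite mulr_ge0 ?expR_ge0// divr_ge0 ?mulr_ge0// ltW.
Qed.

Lemma integral_rayleigh_pdf_ge (a : R) : 0 <= a ->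
  (\int[lebesgue_measure]_(x in `[a, +oo[) (rayleigh_pdf mu x)%:E =
   (expR (- a ^+ 2 / mu))%:E)%E.
Proof.
move=> a0.
transitivity (\int[lebesgue_measure]_(x in `[a, +oo[)
    (2 * x / mu * expR (- x ^+ 2 / mu))%:E)%E.
  apply: eq_integral => x; rewrite inE/= in_itv/= andbT => ax.
  by rewrite /rayleigh_pdf (le_trans a0 ax).
have dF x : is_derive x 1 (fun y => - expR (- y ^+ 2 / mu))
    (2 * x / mu * expR (- x ^+ 2 / mu)).
  by rewrite -[X in is_derive _ _ _ X]opprK; exact: is_deriveN.
rewrite (integraly_is_derive dF (l := 0)).
- by rewrite sub0r opprK.
- move=> x; apply: cvgM; last first.
    exact: (is_derive_continuous is_derive_rayleigh_survival).
  by apply: cvgMr_tmp; apply: cvgMl_tmp; exact: cvg_id.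
- move=> x ax; rewrite mulr_ge0 ?expR_ge0// divr_ge0 ?mulr_ge0//.
    exact: le_trans ax.
  exact: ltW.
- rewrite -oppr0; apply: cvgN.
  under eq_fun do rewrite mulNr.
  apply: (cvg_comp (fun x => x ^+ 2 / mu) (fun x => expR (- x))).
    by apply: gt0_cvgMly; [rewrite invr_gt0|exact: cvgr_expr2].
  exact: cvgr_expR.
Qed.

(** With [u x = t - x ^+ 2 / mu], the two exponentials multiply to the constant [expR (- t)], and
    [2 * x / mu] is [- u']. The integrand is thus the derivative of a polynomial in [u], which runs
    from [t] down to 0. *)
Lemma integral_rayleigh_erlang n t : 0 <= t ->
  (\int[lebesgue_measure]_(x in `[0%R, Num.sqrt (mu * t)])
     (erlang_tail n (t - x ^+ 2 / mu) * rayleigh_pdf mu x)%:E =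
   (\sum_(j < n) gamma_pdf j.+1 t)%:E)%E.
Proof.
move=> t0; pose u x := t - x ^+ 2 / mu.
pose K m x := - \sum_(j < m) (expR (- t) * (u x ^+ j.+1 / (j.+1)`!%:R)).
pose k m x :=
    (\sum_(j < m) expR (- t) * (u x ^+ j / j`!%:R)) * (2 * x / mu).
have du x : is_derive x 1 u (- (2 * x / mu)).
  have dX := is_derive_exp_fun 2 (is_derive_id x 1).
  have dXm := is_derive_mul_fun dX (is_derive_cst (mu^-1 : R) x 1).
  apply: is_derive_eq (is_deriveB (is_derive_cst t x 1) dXm) _.
  by rewrite /cst /=; ring.
have dK m x : is_derive x 1 (K m) (k m x).
  elim: m => [|m IH].
    rewrite (_ : K 0%N = cst 0) /k ?big_ord0.
      by rewrite mul0r; exact: is_derive_cst.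
    by apply/funext => y; rewrite /K big_ord0 oppr0.
  rewrite (_ : K m.+1 = (fun y => K m y - expR (- t) / (m.+1)`!%:R * u y ^+ m.+1)).
    have dU := is_derive_exp_fun m.+1 (du x).
    have := is_derive_mul_fun (is_derive_cst (expR (- t) / (m.+1)`!%:R : R) x 1) dU.
    move=> /(is_deriveB IH)/is_derive_eq; apply.
    rewrite /k big_ord_recr /cst /= factS natrM.
    by field; rewrite addrC natr1 !pnatr_eq0 -lt0n fact_gt0 gt_eqF.
  by apply/funext => y; rewrite /K big_ord_recr opprD; congr (_ - _); ring.
have ck m : continuous (k m).
  move=> x; rewrite /k; apply: cvgM; last first.
    by apply: cvgMr_tmp; apply: cvgMl_tmp; exact: cvg_id.
  apply: cvg_big => [|j _]; first exact: add_continuous.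
  apply: cvgMl_tmp; apply: cvgMr_tmp.
  exact: (is_derive_continuous (fun x => is_derive_exp_fun j (du x))).
transitivity (\int[lebesgue_measure]_(x in `[0%R, Num.sqrt (mu * t)]) (k n x)%:E)%E.
  apply: eq_integral => x; rewrite inE/= in_itv/= => /andP[x0 _].
  rewrite /rayleigh_pdf x0 /erlang_tail /k !mulr_suml; congr (_%:E).
  apply: eq_bigr => j _; rewrite /gamma_pdf -/(u x).
  have -> : expR (- t) = expR (- u x) * expR (- x ^+ 2 / mu).
    by rewrite -expRD; congr expR; rewrite /u; ring.
  by ring.
rewrite (integral_is_derive _ (dK n) (ck n))//; congr (_%:E).
rewrite /K opprK -sumrN -big_split/=; apply: eq_bigr => j _.
rewrite /u sqr_sqrtr ?mulr_ge0// ?ltW//.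
rewrite [mu * t]mulrC mulfK ?gt_eqF// subrr expr0n /= mul0r mulr0 oppr0 add0r.
by rewrite (expr0n _ 2) mul0r subr0 /gamma_pdf mulrC.
Qed.

Hypothesis X_indep : mutually_independent X.
Hypothesis X_rayleigh : forall i, has_density (X i) (rayleigh_pdf mu).

(** Condition on the last variable [v]: if [v ^+ 2 / mu <= t], the other [n] must exceed the
    nonnegative level [t - v ^+ 2 / mu]; otherwise [t] is already exceeded. This is why [t] stays
    general in the induction. *)
Lemma rayleigh_sum_tail n t : 0 <= t ->
  P (partial_sum X (fun x => x ^+ 2 / mu) n @^-1` `]t, +oo[) =
  (erlang_tail n t)%:E.
Proof.
elim: n t => [|n IH] t t0.
  rewrite (_ : _ @^-1` _ = set0) ?measure0 ?/erlang_tail ?big_ord0//.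
  apply/seteqP; split => // w; rewrite /partial_sum /= big_ord0 in_itv/= andbT.
  by rewrite ltNge t0.
have mf : measurable_fun setT (fun x : R => x ^+ 2 / mu).
  by apply: measurable_funM => //; exact: measurable_funX.
pose H v := P [set w | `]t, +oo[%classic
  (partial_sum X (fun x => x ^+ 2 / mu) n w + v ^+ 2 / mu)].
have mH : measurable_fun setT H by exact: measurable_partial_sum_section.
have HE v : H v = (if v ^+ 2 / mu <= t then erlang_tail n (t - v ^+ 2 / mu)
                   else 1)%:E.
  rewrite /H; case: leP => vt.
    rewrite -IH ?subr_ge0//; congr (P _).
    by apply/seteqP; split => w /=; rewrite !in_itv/= !andbT ltrBlDr.
  rewrite -(probability_setT P); congr (P _); apply/seteqP; split => // w _ /=.
  rewrite in_itv/= andbT (lt_le_trans vt)// lerDr; apply: sumr_ge0 => i _.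
  by rewrite divr_ge0 ?sqr_ge0// ltW.
rewrite partial_sumS_probability//.
rewrite (ge0_integral_density measurable_rayleigh_pdf rayleigh_pdf_ge0
  (X_rayleigh n) mH)//.
set F := (fun x => H x * _)%E.
have mF : measurable_fun setT F.
  apply: emeasurable_funM; first exact: mH.
  by apply/measurable_EFinP; exact: measurable_rayleigh_pdf.
have F0 x : (0 <= F x)%E by rewrite mule_ge0// ?lee_fin ?rayleigh_pdf_ge0.
have a0 : 0 <= Num.sqrt (mu * t) by [].
have mut x : 0 <= x -> (x ^+ 2 / mu <= t) = (x <= Num.sqrt (mu * t)).
  move=> x0; rewrite ler_pdivrMr// mulrC -[in RHS](ger0_norm x0) -sqrtr_sqr.
  by rewrite ler_sqrt// mulr_ge0// ltW.
transitivity (\int[lebesgue_measure]_(x in `[0%R, +oo[) F x)%E.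
  rewrite [RHS]integral_mkcond; apply: eq_integral => x _.
  rewrite patchE; case: ifPn => //; rewrite mem_setE in_itv/= andbT -ltNge => x0.
  by rewrite /F /rayleigh_pdf leNgt x0 mule0.
rewrite (@itv_bndbnd_setU _ _ _ (BRight (Num.sqrt (mu * t)))) ?bnd_simp//.
rewrite ge0_integral_setU//=; first last.
- apply/disj_setPS => x /= []; rewrite !in_itv/= andbT => /andP[_ xa].
  by rewrite ltNge xa.
- exact: measurable_funTS.
(* The part below [Num.sqrt (mu * t)] yields the terms of positive index, the part above it the term
   of index 0. *)
rewrite (_ : erlang_tail n.+1 t =
    \sum_(j < n) gamma_pdf j.+1 t + expR (- Num.sqrt (mu * t) ^+ 2 / mu)).
  rewrite EFinD -integral_rayleigh_erlang// -integral_rayleigh_pdf_ge//.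
  rewrite -(@integral_itv_obnd_cbnd _ (Num.sqrt (mu * t))); last first.
    apply/measurable_EFinP; apply: measurable_funTS.
    exact: measurable_rayleigh_pdf.
  congr (_ + _)%E; apply: eq_integral => x; rewrite inE/= in_itv/= ?andbT.
    by move=> /andP[x0 xa]; rewrite /F HE mut// xa EFinM.
  move=> ax; have x0 : 0 <= x by rewrite ltW// (le_lt_trans a0 ax).
  by rewrite /F HE mut// leNgt ax mul1e.
rewrite /erlang_tail big_ord_recl addrC; congr (_ + _).
rewrite /gamma_pdf divr1 mul1r sqr_sqrtr ?mulr_ge0// ?ltW//.
by rewrite mulNr [mu * t]mulrC mulfK ?gt_eqF.
Qed.

End rayleigh_sums.

(** * Bounds on the logarithm and on the standardised gamma density *)

Section log_bounds.
Context (R : realType).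
Implicit Types (F : R -> R) (u w t : R).

Let mean_value1 F F' w :
  (forall c : R, 0 < c -> is_derive c 1 F (F' c)) -> 0 < w ->
  exists2 c, 0 < c & F w - F 1 = F' c * (w - 1).
Proof.
move=> dF w0; have cF c : 0 < c -> {for c, continuous F}.
  move=> c0; apply/differentiable_continuous/derivable1_diffP.
  by have := dF c c0 => -[].
have [w1|w1|->] := ltgtP w 1; last by exists 1 => //; rewrite !subrr mulr0.
- have [c||c] := @MVT _ F F' w 1 w1.
  + by rewrite in_itv/= => /andP[/(lt_trans w0)/dF].
  + apply: continuous_in_subspaceT => c; rewrite inE/= in_itv/= => /andP[wc _].
    exact/cF/(lt_le_trans w0).
  + rewrite in_itv/= => /andP[wc _] E; exists c; first exact: lt_trans wc.
    by rewrite -opprB E -mulrN opprB.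
- have [c||c] := @MVT _ F F' 1 w w1.
  + by rewrite in_itv/= => /andP[/(lt_trans ltr01)/dF].
  + apply: continuous_in_subspaceT => c; rewrite inE/= in_itv/= => /andP[wc _].
    exact/cF/(lt_le_trans ltr01).
  + rewrite in_itv/= => /andP[wc _] E; exists c => //; exact: lt_trans wc.
Qed.

(** The left-hand side vanishes at 1 and has derivative [(c - 1) ^+ 2 / c >= 0], so it has the sign
    of [w - 1]. Writing it as [r * (w - 1)] covers both sides of 1 at once. *)
Let ln_quadratic w : 0 < w ->
  exists2 r, 0 <= r & ln w - (w - 1) + (w - 1) ^+ 2 / 2 = r * (w - 1).
Proof.
move=> w0.
have [|c c0] := @mean_value1 (fun w => ln w - (w - 1) + (w - 1) ^+ 2 / 2)
  (fun c => (c - 1) ^+ 2 / c) w _ w0.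
  move=> c c0.
  have dl : is_derive c 1 (@ln R) c^-1 by exact: is_derive1_ln.
  have d1 : is_derive c 1 (fun y : R => y - 1) 1.
    have := is_deriveB (is_derive_id c (1 : R)) (is_derive_cst (1 : R) c (1 : R)).
    by rewrite subr0.
  have d2 := is_derive_mul_fun (is_derive_exp_fun 2 d1) (is_derive_cst (2^-1 : R) c 1).
  apply: is_derive_eq (is_deriveD (is_deriveB dl d1) d2) _.
  by rewrite /cst /=; field; rewrite gt_eqF.
rewrite ln1 subrr expr0n/= mul0r !subr0 addr0 subr0 => ->.
by exists ((c - 1) ^+ 2 / c); rewrite // divr_ge0 ?sqr_ge0// ltW.
Qed.

Let ln_rational w : 0 < w ->
  exists2 r, 0 <= r & ln w - (w - 1) + (w - 1) ^+ 2 / (2 * w) = - r * (w - 1).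
Proof.
move=> w0.
(* The same function as in the statement, since [(w - 1) ^+ 2 / (2 * w) - (w - 1) = w^-1 / 2 - w /
   2]. *)
have [|c c0] := @mean_value1 (fun w => ln w - w / 2 + w^-1 / 2)
  (fun c => - ((c - 1) ^+ 2 / (2 * c ^+ 2))) w _ w0.
  move=> c c0.
  have dl : is_derive c 1 (@ln R) c^-1 by exact: is_derive1_ln.
  have d1 := is_derive_mul_fun (is_derive_id c 1) (is_derive_cst (2^-1 : R) c 1).
  have dV : is_derive c 1 (fun y : R => y^-1) (- c ^- 2).
    have cN0 : id c != 0 :> R by rewrite gt_eqF.
    by have := is_deriveV cN0 (is_derive_id c (1 : R)); rewrite /GRing.scale/= mulr1.
  have d2 := is_derive_mul_fun dV (is_derive_cst (2^-1 : R) c 1).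
  apply: is_derive_eq (is_deriveD (is_deriveB dl d1) d2) _.
  by rewrite /cst /=; field; rewrite gt_eqF.
rewrite ln1 invr1 sub0r addNr subr0 => E.
exists ((c - 1) ^+ 2 / (2 * c ^+ 2)).
  by rewrite divr_ge0 ?sqr_ge0// mulr_ge0 ?sqr_ge0.
by rewrite mulNr -mulNr -E; field; rewrite gt_eqF.
Qed.

Lemma ln1D_ge0_bounds u : 0 <= u ->
  - (u ^+ 2 / 2) <= ln (1 + u) - u <= - (u ^+ 2 / (2 * (1 + u))).
Proof.
move=> u0; have u1 : 0 < 1 + u by rewrite ltr_pwDl.
have [r r0] := ln_quadratic u1; have [s s0] := ln_rational u1.
rewrite [1 + u - 1]addrAC subrr add0r => Es Er.
have := mulr_ge0 r0 u0; have := mulr_ge0 s0 u0; move: Es Er; rewrite mulNr.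
by move=> ? ? ? ?; apply/andP; split; lra.
Qed.

Lemma ln1D_le0_bounds u : -1 < u -> u <= 0 ->
  - (u ^+ 2 / (2 * (1 + u))) <= ln (1 + u) - u <= - (u ^+ 2 / 2).
Proof.
move=> uN1 u0; have u1 : 0 < 1 + u by lra.
have [r r0] := ln_quadratic u1; have [s s0] := ln_rational u1.
rewrite [1 + u - 1]addrAC subrr add0r => Es Er.
have := mulr_ge0_le0 r0 u0; have := mulr_ge0_le0 s0 u0.
move: Es Er; rewrite mulNr.
by move=> ? ? ? ?; apply/andP; split; lra.
Qed.

End log_bounds.

(* Up to a constant factor, the density of [(S - N) / sqrt N] for a sum [S] of
   [N = n + 2] independent standard exponential variables. *)
Definition std_gamma_fun (R : realType) n (t : R) : R :=
  Num.max 0 (1 + t / Num.sqrt n.+2%:R) ^+ n.+1 *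
  expR (- (Num.sqrt n.+2%:R * t)).

Section std_gamma_fun.
Context (R : realType).
Implicit Types (n : nat) (t z : R).

Let rt n : R := Num.sqrt n.+2%:R.

Let rt_ge1 n : 1 <= rt n.
Proof. by rewrite -[leLHS]sqrtr1 ler_wsqrtr// ler1n. Qed.

Let rt_gt0 n : 0 < rt n. Proof. exact: lt_le_trans (rt_ge1 n). Qed.

Let rt_sqr n : rt n ^+ 2 = n.+2%:R. Proof. by rewrite sqr_sqrtr. Qed.

Lemma std_gamma_fun_ge0 n t : 0 <= std_gamma_fun n t.
Proof. by rewrite mulr_ge0 ?expR_ge0// exprn_ge0// le_max lexx. Qed.

(** Taking [N = n + 2] keeps the exponent [N - 1] positive, so the power of [max 0 _] vanishes left
    of the support. *)
Lemma std_gamma_fun_eq0 n t : t <= - rt n -> std_gamma_fun n t = 0.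
Proof.
move=> tn; rewrite /std_gamma_fun max_l ?expr0n ?mul0r//.
have : t / rt n <= - 1 by rewrite ler_pdivrMr// mulN1r.
by rewrite -/(rt n); lra.
Qed.

Lemma std_gamma_funE n t : - rt n < t ->
  std_gamma_fun n t =
  expR (n.+1%:R * ln (1 + t / rt n) - n.+2%:R * (t / rt n)).
Proof.
move=> tn; have u1 : 0 < 1 + t / rt n.
  by rewrite -ltrBlDl sub0r ltr_pdivlMr// mulN1r.
rewrite /std_gamma_fun -/(rt n) max_r ?ltW//.
rewrite expRD expRM_natl lnK ?posrE//; congr (_ * expR _).
by rewrite -rt_sqr; field; rewrite gt_eqF.
Qed.

(** Let [u = t / sqrt N]. For [t >= 0] the exponent is at most [- t ^+ 2 / (2 * (1 + t))], as
    [u <= t], hence at most [1 / 2 - t / 2]. For [t < 0] it is at most [- (N - 1) * u ^+ 2 / 2 - u],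
    where [(N - 1) * u ^+ 2 >= t ^+ 2 / 2] and [- u < 1], hence at most [5 / 4 - |t| / 2]. The
    constant 2 covers both cases. *)
Lemma std_gamma_fun_le n t : std_gamma_fun n t <= expR (2 - `|t| / 2).
Proof.
have [tn|tn] := leP t (- rt n); first by rewrite std_gamma_fun_eq0// expR_ge0.
rewrite std_gamma_funE// ler_expR; set u := t / rt n.
have ut : t = u * rt n by rewrite /u divfK// gt_eqF.
have t2 : t ^+ 2 = u ^+ 2 * n.+2%:R by rewrite -rt_sqr -exprMn -ut.
have n2 : n.+2%:R = n.+1%:R + 1 :> R by rewrite -natr1.
have n1 : 1 <= n.+1%:R :> R by rewrite ler1n.
have [t0|t0] := leP 0 t.
  have u0 : 0 <= u by rewrite divr_ge0 ?(ltW (rt_gt0 n)).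
  have ut' : u <= t by rewrite [leRHS]ut ler_peMr.
  have /andP[_ lnu] := ln1D_ge0_bounds u0.
  have lnu0 : 0 <= ln (1 + u) by rewrite ln_ge0// lerDl.
  have : n.+2%:R * (ln (1 + u) - u) <= - (t ^+ 2 / (1 + t) / 2).
    apply: (@le_trans _ _ (n.+2%:R * - (u ^+ 2 / (2 * (1 + u))))).
      by rewrite ler_wpM2l.
    rewrite mulrN lerN2 -mulrA -invfM t2 mulrA [n.+2%:R * _]mulrC.
    apply: ler_wpM2l; first by rewrite mulr_ge0 ?sqr_ge0.
    by rewrite lef_pV2 ?posrE ?mulr_gt0 ?ltr_wpDr//; lra.
  have : t - 1 <= t ^+ 2 / (1 + t).
    by rewrite ler_pdivlMr ?ltr_wpDr//; lra.
  rewrite ger0_norm//; move: lnu0; rewrite n2.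
  set a := ln _; set b := t ^+ 2 / _; set k := n.+1%:R.
  by move=> ? ? ?; lra.
have u0 : u <= 0 by rewrite /u pmulr_lle0 ?invr_gt0// ltW.
have uN1 : -1 < u by rewrite ltr_pdivlMr// mulN1r.
have /andP[_ lnu] := ln1D_le0_bounds uN1 u0.
have : n.+1%:R * (ln (1 + u) - u) <= n.+1%:R * - (u ^+ 2 / 2).
  by rewrite ler_wpM2l.
have : u ^+ 2 * 1 <= u ^+ 2 * n.+1%:R by rewrite ler_wpM2l ?sqr_ge0.
have : 0 <= (t + 1) ^+ 2 by rewrite sqr_ge0.
rewrite ltr0_norm// n2; rewrite n2 in t2.
move: t2 uN1 u0; set a := ln _; set k := n.+1%:R.
by move=> ? ? ? ? ? ?; lra.
Qed.

Lemma measurable_std_gamma_fun n : measurable_fun setT (@std_gamma_fun R n).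
Proof.
apply: measurable_funM.
  apply: measurable_funX; apply: measurable_maxr => //.
  by apply: measurable_funD => //; exact: measurable_funM.
by apply: measurableT_comp => //; apply: measurableT_comp => //.
Qed.

Lemma cvg_sqrt_nat : Num.sqrt n.+2%:R @[n --> \oo] --> (+oo : set_system R).
Proof.
apply/cvgryPge => M; near=> n.
rewrite (le_trans (ler_norm M))// -sqrtr_sqr ler_wsqrtr//.
apply: (@le_trans _ _ n%:R); last by rewrite ler_nat -addn2 leq_addr.
by near: n; exact: nbhs_infty_ger.
Unshelve. all: by end_near. Qed.

(** The logarithmic bounds squeeze [N * (ln (1 + u) - u)] between [- t ^+ 2 / 2] and the same
    divided by [1 + u], in an order depending on the sign of [t]. Having [N - 1] instead of [N] as
    exponent costs only [ln (1 + u)], which tends to 0. *)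
Lemma cvg_std_gamma_fun t :
  std_gamma_fun n t @[n --> \oo] --> expR (- t ^+ 2 / 2).
Proof.
have u0 : t / rt n @[n --> \oo] --> (0 : R).
  have : (rt n)^-1 @[n --> \oo] --> (0 : R).
    by apply/gtr0_cvgV0; [exact: nearW|exact: cvg_sqrt_nat].
  by move/(@cvgMl_tmp _ _ _ _ _ t); rewrite mulr0.
have u1 : 1 + t / rt n @[n --> \oo] --> (1 : R).
  by have /(cvgD (cvg_cst (1 : R))) := u0; rewrite addr0.
have tn : \forall n \near \oo, - rt n < t.
  have /cvgryPgt/(_ (- t)) := cvg_sqrt_nat.
  by apply: filterS => n; rewrite -/(rt n); lra.
have lim_main : n.+2%:R * (ln (1 + t / rt n) - t / rt n) @[n --> \oo] -->
    - t ^+ 2 / 2.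
  have low : cst (- t ^+ 2 / 2) n @[n --> \oo] --> - t ^+ 2 / 2 by exact: cvg_cst.
  have high : - t ^+ 2 / 2 * (1 + t / rt n)^-1 @[n --> \oo] --> - t ^+ 2 / 2.
    have : (1 + t / rt n)^-1 @[n --> \oo] --> (1^-1 : R).
      by apply: cvgV => //; exact: oner_neq0.
    by move/(@cvgMl_tmp _ _ _ _ _ (- t ^+ 2 / 2)); rewrite invr1 mulr1.
  have tu n : n.+2%:R * - ((t / rt n) ^+ 2 / 2) = - t ^+ 2 / 2.
    by rewrite -rt_sqr; field; rewrite gt_eqF.
  have tu' n : - rt n < t -> n.+2%:R * - ((t / rt n) ^+ 2 / (2 * (1 + t / rt n))) =
      - t ^+ 2 / 2 * (1 + t / rt n)^-1.
    by move=> tn'; rewrite -(tu n) invfM; ring.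
  have [t0|t0] := leP 0 t.
    apply: squeeze_cvgr low high; near=> n.
    have /andP[h1 h2] := @ln1D_ge0_bounds R (t / rt n)
      (divr_ge0 t0 (ltW (rt_gt0 n))).
    have tn' : - rt n < t by near: n.
    by apply/andP; split; [rewrite /= -(tu n)|rewrite /= -tu'//]; rewrite ler_wpM2l.
  apply: squeeze_cvgr high low; near=> n.
  have tn' : - rt n < t by near: n.
  have uN1 : -1 < t / rt n by rewrite ltr_pdivlMr// mulN1r.
  have u0' : t / rt n <= 0 by rewrite pmulr_lle0 ?invr_gt0// ltW.
  have /andP[h1 h2] := ln1D_le0_bounds uN1 u0'.
  by apply/andP; split; [rewrite /= -tu'//|rewrite /= -(tu n)]; rewrite ler_wpM2l.
have lim_ln : ln (1 + t / rt n) @[n --> \oo] --> (0 : R).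
  rewrite -ln1; apply: (cvg_comp _ (@ln R)); first exact: u1.
  exact: continuous_ln.
have lim_exp : n.+2%:R * (ln (1 + t / rt n) - t / rt n) - ln (1 + t / rt n)
    @[n --> \oo] --> - t ^+ 2 / 2.
  by have := cvgB lim_main lim_ln; rewrite subr0; exact.
apply: (@cvg_trans _ (expR (n.+2%:R * (ln (1 + t / rt n) - t / rt n)
   - ln (1 + t / rt n)) @[n --> \oo])).
  apply: near_eq_cvg; near=> n; rewrite std_gamma_funE; last by near: n.
  have n2 : n.+2%:R = n.+1%:R + 1 :> R by rewrite natr1.
  by congr expR; rewrite n2; ring.
by apply: (cvg_comp _ expR); [exact: lim_exp|exact: continuous_expR].
Unshelve. all: by end_near. Qed.

End std_gamma_fun.

(** * Central limit theorem for Erlang windows *)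

Section half_square_exponential.
Context (R : realType).

Lemma is_derive_half_sqr_exp (t : R) :
  is_derive t 1 (fun y => expR (- y ^+ 2 / 2)) (- (t * expR (- t ^+ 2 / 2))).
Proof.
have dX := is_derive_exp_fun 2 (is_derive_id t (1 : R)).
have dXm := is_derive_mul_fun (is_deriveN dX) (is_derive_cst (2^-1 : R) t 1).
apply: is_derive_eq (is_derive_expR_fun dXm) _.
by rewrite /cst /=; field.
Qed.

Lemma continuous_half_sqr_exp : continuous (fun t : R => expR (- t ^+ 2 / 2)).
Proof. exact: is_derive_continuous is_derive_half_sqr_exp. Qed.

Lemma normal_prob01E (D : set R) : measurable D ->
  (normal_prob 0 1 D = ((Num.sqrt (2 * pi))^-1)%:E *
    \int[lebesgue_measure]_(x in D) (expR (- x ^+ 2 / 2))%:E)%E.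
Proof.
move=> mD; rewrite -ge0_integralZl//.
- apply: eq_integral => x _; rewrite -EFinM normal_pdfE ?oner_neq0//.
  rewrite /normal_peak /normal_fun subr0 expr1n mul1r; congr (_ * expR (_ / _))%:E.
  by congr (Num.sqrt _)^-1; rewrite -mulr_natl.
- apply/measurable_EFinP; apply: measurable_funTS.
  by apply: continuous_measurable_fun; exact: continuous_half_sqr_exp.
Qed.

End half_square_exponential.

Section gamma_central_limit.
Context (R : realType).
Implicit Types (n : nat) (t z : R).

Let rt n : R := Num.sqrt n.+2%:R.

Let rt_gt0 n : 0 < rt n. Proof. by rewrite sqrtr_gt0. Qed.

Let rt_sqr n : rt n ^+ 2 = n.+2%:R. Proof. by rewrite sqr_sqrtr. Qed.

(** For [0 <= z <= sqrt n], the probability that a sum of [n] standard exponentials lies in the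
    window open on the left and closed on the right. For larger [z] the left endpoint is negative,
    where [erlang_tail] is not a tail probability. *)
Definition erlang_window n z : R :=
  erlang_tail n (n%:R - z * Num.sqrt n%:R) -
  erlang_tail n (n%:R + z * Num.sqrt n%:R).

Let density n t := rt n * gamma_pdf n.+1 (n.+2%:R + rt n * t).

Let const n := rt n * gamma_pdf n.+1 n.+2%:R.

Let is_derive_tail n t :
  is_derive t 1 (fun y => - erlang_tail n.+2 (n.+2%:R + rt n * y)) (density n t).
Proof.
have d1 : is_derive t 1 (fun y => n.+2%:R + rt n * y) (rt n).
  have := is_deriveD (is_derive_cst (n.+2%:R : R) t 1)
    (is_derive_mul_fun (is_derive_cst (rt n) t 1) (is_derive_id t (1 : R))).
  by rewrite /cst/= mulr1 mulr0 addr0 add0r; exact.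
have := @is_derive1_comp R (erlang_tail n.+2) _ t _ _
  (is_derive_erlang_tail n.+1 (n.+2%:R + rt n * t)) d1.
move=> /is_deriveN/is_derive_eq; apply.
by rewrite mulNr opprK mulrC.
Qed.

Let continuous_density n : continuous (density n).
Proof.
move=> t; apply: cvgMl_tmp.
apply: (cvg_comp (fun t => n.+2%:R + rt n * t)); last exact: continuous_gamma_pdf.
by apply: cvgD; [exact: cvg_cst|apply: cvgMl_tmp; exact: cvg_id].
Qed.

Let densityE n t : - rt n <= t -> density n t = const n * std_gamma_fun n t.
Proof.
move=> tn; have u1 : 0 <= 1 + t / rt n.
  by rewrite -lerBlDl sub0r ler_pdivlMr// mulN1r.
rewrite /density /const /std_gamma_fun -/(rt n) max_r// /gamma_pdf.
rewrite opprD expRD.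
have -> : n.+2%:R + rt n * t = n.+2%:R * (1 + t / rt n).
  by rewrite -rt_sqr; field; rewrite gt_eqF.
by rewrite exprMn; ring.
Qed.

Let const_gt0 n : 0 < const n.
Proof.
by rewrite mulr_gt0// mulr_gt0 ?expR_gt0// divr_gt0 ?exprn_gt0// ltr0n fact_gt0.
Qed.

Let integral_window n z : 0 <= z -> z <= rt n ->
  ((const n)%:E * \int[lebesgue_measure]_(t in `[(- z)%R, z]) (std_gamma_fun n t)%:E
   = (erlang_window n.+2 z)%:E)%E.
Proof.
move=> z0 zn; rewrite -ge0_integralZl//; last 3 first.
- apply/measurable_EFinP; apply: measurable_funTS.
  exact: measurable_std_gamma_fun.
- by move=> t _; rewrite lee_fin std_gamma_fun_ge0.
- by rewrite lee_fin ltW.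
transitivity (\int[lebesgue_measure]_(t in `[(- z)%R, z]) (density n t)%:E)%E.
  apply: eq_integral => t; rewrite inE/= in_itv/= => /andP[zt _].
  by rewrite densityE ?EFinM// (le_trans _ zt)// lerN2.
rewrite (integral_is_derive _ (is_derive_tail n) (@continuous_density n)).
  rewrite /erlang_window -/(rt n); congr (_%:E).
  by rewrite opprK addrC mulrN ![rt n * z]mulrC.
by rewrite -subr_ge0 opprK addr_ge0.
Qed.

(* Since the total mass is [1], [const n] is recovered from the integral of
   [std_gamma_fun n], so Stirling's formula is not needed. *)
Let integral_total n :
  ((const n)%:E * \int[lebesgue_measure]_t (std_gamma_fun n t)%:E = 1)%E.
Proof.
rewrite -ge0_integralZl//; last 3 first.
- by apply/measurable_EFinP; exact: measurable_std_gamma_fun.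
- by move=> t _; rewrite lee_fin std_gamma_fun_ge0.
- by rewrite lee_fin ltW.
transitivity (\int[lebesgue_measure]_(t in `[(- rt n)%R, +oo[) (density n t)%:E)%E.
  rewrite [RHS]integral_mkcond; apply: eq_integral => t _.
  rewrite patchE; case: ifPn.
    by rewrite inE/= in_itv/= andbT => tn; rewrite densityE ?EFinM.
  rewrite mem_setE in_itv/= andbT -ltNge => tn.
  by rewrite std_gamma_fun_eq0 ?mule0// ltW.
rewrite (integraly_is_derive (is_derive_tail n) (l := 0))//.
- by rewrite mulrN -expr2 rt_sqr subrr erlang_tail0 opprK add0r.
- move=> t tn; rewrite densityE// mulr_ge0 ?std_gamma_fun_ge0//.
  exact/ltW.
- rewrite -oppr0; apply: cvgN.
  apply: (cvg_comp (fun y => n.+2%:R + rt n * y)); last exact: cvg_erlang_tail.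
  apply: (cvg_comp (fun y => rt n * y) (fun y => n.+2%:R + y)).
    by apply: gt0_cvgMry => //; exact: cvg_id.
  exact: cvg_addrl.
Qed.

Let integrable_dominant : lebesgue_measure.-integrable [set: R]
  (fun t => (expR (2 - `|t| / 2))%:E).
Proof.
have cf : continuous (fun t : R => expR (2 - `|t| / 2)).
  move=> t; apply: (cvg_comp _ expR); last exact: continuous_expR.
  apply: cvgB; first exact: cvg_cst.
  by apply: cvgMr_tmp; exact: norm_continuous.
apply/integrableP; split.
  by apply/measurable_EFinP; exact: continuous_measurable_fun.
under eq_integral do rewrite gee0_abs ?lee_fin ?expR_ge0//.
rewrite ge0_symfun_integralT//; last by move=> t /=; rewrite normrN.
rewrite -set_itvcy.
have dF (t : R) : is_derive t 1 (fun y => - 2 * expR (2 - y / 2)) (expR (2 - t / 2)).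
  have d0 := is_derive_mul_fun (is_derive_id t (1 : R)) (is_derive_cst (2^-1 : R) t 1).
  have d1 := is_deriveB (is_derive_cst (2 : R) t 1) d0.
  have := is_derive_mul_fun (is_derive_cst (- 2 : R) t 1) (is_derive_expR_fun d1).
  move/is_derive_eq; apply.
  by rewrite /cst /=; field.
have cdF : continuous (fun t : R => expR (2 - t / 2)).
  move=> t; apply: (cvg_comp _ expR); last exact: continuous_expR.
  apply: cvgB; first exact: cvg_cst.
  by apply: cvgMr_tmp; exact: cvg_id.
under eq_integral => t t0.
  rewrite ger0_norm; last by move: t0; rewrite inE/= in_itv/= andbT.
  over.
rewrite (integraly_is_derive dF cdF (l := 0)) ?ltry//.
have : expR (2 - t / 2) @[t --> +oo] --> (0 : R).
  under eq_fun do rewrite -opprB.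
  apply: (cvg_comp (fun t => t / 2 - 2) (fun t => expR (- t))).
    apply: (cvg_comp (fun t => t / 2) (fun t => t - 2)).
      by apply: gt0_cvgMly => //; exact: cvg_id.
    exact: cvg_addrr.
  exact: cvgr_expR.
by move/(@cvgMl_tmp _ _ _ _ _ (- 2)); rewrite mulr0.
Qed.

Let integral_fin (f : R -> R) (D : set R) : measurable D ->
  measurable_fun setT f -> (forall t, 0 <= f t <= expR (2 - `|t| / 2)) ->
  (\int[lebesgue_measure]_(t in D) (f t)%:E \is a fin_num)%E.
Proof.
move=> mD mf fb; have f0 t : 0 <= f t by have /andP[] := fb t.
apply: integrable_fin_num => //.
suff iT : lebesgue_measure.-integrable setT (fun t => (f t)%:E).
  by apply: (integrableS _ _ _ iT).
apply: (le_integrable _ _ _ integrable_dominant) => //.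
  exact/measurable_EFinP.
move=> t _; rewrite !gee0_abs ?lee_fin ?expR_ge0//.
by have /andP[] := fb t.
Qed.

Let half_sqr_exp_bound t : 0 <= expR (- t ^+ 2 / 2) <= expR (2 - `|t| / 2).
Proof.
rewrite expR_ge0 ler_expR -real_normK ?num_real//.
have := sqr_ge0 (`|t| - 1); have := normr_ge0 t; lra.
Qed.

Let cvg_integral_std_gamma (D : set R) : measurable D ->
  (fine (\int[lebesgue_measure]_(t in D) (std_gamma_fun n t)%:E)
    @[n --> \oo] -->
   fine (\int[lebesgue_measure]_(t in D) (expR (- t ^+ 2 / 2))%:E))%E.
Proof.
move=> mD.
have mh n : measurable_fun D (fun t : R => (std_gamma_fun n t)%:E).
  by apply/measurable_EFinP; apply: measurable_funTS; exact: measurable_std_gamma_fun.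
have mg : measurable_fun D (fun t : R => (expR (- t ^+ 2 / 2))%:E).
  apply/measurable_EFinP; apply: measurable_funTS.
  by apply: continuous_measurable_fun; exact: continuous_half_sqr_exp.
have hg : {ae lebesgue_measure, forall t, D t ->
    (std_gamma_fun n t)%:E @[n --> \oo] --> (expR (- t ^+ 2 / 2))%:E}.
  by apply: aeW => t _; apply: cvg_EFin; [exact: nearW|exact: cvg_std_gamma_fun].
have hle : {ae lebesgue_measure, forall t n, D t ->
    (`|(std_gamma_fun n t)%:E| <= (expR (2 - `|t| / 2))%:E)%E}.
  apply: aeW => t n _; rewrite gee0_abs ?lee_fin ?std_gamma_fun_ge0//.
  exact: std_gamma_fun_le.
have iD : lebesgue_measure.-integrable D (fun t => (expR (2 - `|t| / 2))%:E).
  by apply: (integrableS _ _ _ integrable_dominant).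
have [ig _ cvgi] := @dominated_convergence _ _ R lebesgue_measure D mD
  _ _ _ mh mg hg iD hle.
by apply: fine_cvg; rewrite fineK//; apply: integrable_fin_num.
Qed.

(** Once [z <= sqrt N], the window is the ratio of the integrals of [std_gamma_fun] over [[- z, z]]
    and over the line; dominated convergence applies to both. *)
Lemma cvg_erlang_window z : 0 < z ->
  erlang_window n.+2 z @[n --> \oo] --> fine (normal_prob 0 1 `[- z, z]).
Proof.
move=> z0.
pose I (D : set R) n :=
  fine (\int[lebesgue_measure]_(t in D) (std_gamma_fun n t)%:E)%E.
pose J (D : set R) :=
  fine (\int[lebesgue_measure]_(t in D) (expR (- t ^+ 2 / 2))%:E)%E.
have JE D : measurable D -> J D = Num.sqrt (2 * pi) * fine (normal_prob 0 1 D).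
  move=> mD; rewrite normal_prob01E// fineM//.
    by rewrite mulrA divff ?mul1r// gt_eqF// sqrtr_gt0 mulr_gt0// pi_gt0.
  apply: integral_fin => //.
  by apply: continuous_measurable_fun; exact: continuous_half_sqr_exp.
(* The value of the Gaussian integral is read off from the total mass 1 of [normal_prob]. *)
have JT : J setT = Num.sqrt (2 * pi) by rewrite JE// probability_setT mulr1.
have lim : I `[- z, z]%classic n / I setT n @[n --> \oo] -->
    fine (normal_prob 0 1 `[- z, z]).
  have -> : fine (normal_prob 0 1 `[- z, z]) = J `[- z, z]%classic / J setT.
    by rewrite JT JE// mulrC mulKf// gt_eqF// sqrtr_gt0 mulr_gt0// pi_gt0.
  apply: cvgM; first exact: cvg_integral_std_gamma.
  apply: cvgV; last exact: cvg_integral_std_gamma.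
  by rewrite JT gt_eqF// sqrtr_gt0 mulr_gt0// pi_gt0.
apply: cvg_trans lim; apply: near_eq_cvg; near=> n.
have zn : z <= rt n.
  by near: n; have /cvgryPge := @cvg_sqrt_nat R; exact.
have fin D : measurable D ->
    (\int[lebesgue_measure]_(t in D) (std_gamma_fun n t)%:E = (I D n)%:E)%E.
  move=> mD; rewrite fineK//; apply: integral_fin => //.
    exact: measurable_std_gamma_fun.
  by move=> t; rewrite std_gamma_fun_ge0 std_gamma_fun_le.
have := integral_total n; rewrite (fin setT)// -EFinM => -[E1].
have := integral_window (ltW z0) zn; rewrite (fin `[(- z)%R, z]%classic)// -EFinM => -[<-].
have c0 : const n != 0 by rewrite gt_eqF.
rewrite (_ : I setT n = (const n)^-1) ?invrK; first by rewrite mulrC.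
by apply: (mulfI c0); rewrite E1 divff.
Unshelve. all: by end_near. Qed.

End gamma_central_limit.

(** * The normal tail and the asymptotics of its quantile *)

Definition normal_tail (R : realType) (z : R) : R :=
  fine (normal_prob 0 1 `]z, +oo[%classic).

Section normal_tail.
Context (R : realType).
Implicit Types a b z delta : R.

Let N : probability _ R := normal_prob (0 : R) 1.

Let peak : R := (Num.sqrt (2 * pi))^-1.

Let two_pi_ge1 : 1 <= 2 * pi :> R.
Proof. by have := pi_ge2 R; lra. Qed.

Let peak_gt0 : 0 < peak.
Proof. by rewrite invr_gt0 sqrtr_gt0 mulr_gt0// pi_gt0. Qed.

Let peak_le1 : peak <= 1.
Proof.
rewrite invf_le1 ?sqrtr_gt0 ?mulr_gt0 ?pi_gt0//.
by rewrite -[leLHS]sqrtr1 ler_wsqrtr.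
Qed.

Let mg (D : set R) : measurable_fun D (fun t : R => (expR (- t ^+ 2 / 2))%:E).
Proof.
apply/measurable_EFinP; apply: measurable_funTS.
by apply: continuous_measurable_fun; exact: continuous_half_sqr_exp.
Qed.

Let NE (D : set R) : measurable D ->
  (N D = peak%:E * \int[lebesgue_measure]_(x in D) (expR (- x ^+ 2 / 2))%:E)%E.
Proof. exact: normal_prob01E. Qed.

Let N_fin (D : set R) : measurable D -> N D \is a fin_num.
Proof. by move=> mD; exact: fin_num_measure. Qed.

(** Source of strict decrease, of the Lipschitz bound and of the lower tail bound, through different
    choices of [l] and [u]. *)
Let N_itv_bounds a b (l u : R) : 0 <= l -> a <= b ->
  (forall x, a <= x <= b -> l <= expR (- x ^+ 2 / 2) <= u) ->
  peak * l * (b - a) <= fine (N `]a, b]%classic) <= peak * u * (b - a).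
Proof.
move=> l0 ab lu; have mab : measurable (`]a, b]%classic : set R) by [].
have cstE (r : R) : ((peak * r * (b - a))%:E =
    peak%:E * \int[lebesgue_measure]_(x in `]a, b]) cst r%:E x)%E.
  rewrite integral_cst//= lebesgue_measure_itv/= lte_fin.
  case: ltP => [_|ba]; first by rewrite -EFinB -!EFinM mulrA.
  by rewrite mule0 mule0 (_ : b - a = 0) ?mulr0//; lra.
have lux x : `]a, b]%classic x -> l <= expR (- x ^+ 2 / 2) <= u.
  by rewrite /= in_itv/= => /andP[ax xb]; apply: lu; rewrite ltW.
rewrite -!lee_fin fineK ?N_fin// NE// !cstE; apply/andP; split.
- apply: lee_wpmul2l; first by rewrite lee_fin ltW.
  apply: ge0_le_integral => //; first exact: mg.
  by move=> x /lux/andP[+ _]; rewrite lee_fin.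
- apply: lee_wpmul2l; first by rewrite lee_fin ltW.
  apply: ge0_le_integral => //; first exact: mg.
  by move=> x /lux/andP[_]; rewrite lee_fin.
Qed.

Lemma normal_tailB a b : a <= b ->
  normal_tail a - normal_tail b = fine (N `]a, b]%classic).
Proof.
move=> ab; apply/eqP; rewrite subr_eq; apply/eqP.
rewrite /normal_tail (@itv_bndbnd_setU _ _ _ (BRight b)) ?bnd_simp//.
rewrite measureU//; first by rewrite fineD// N_fin.
apply/seteqP; split => // x /= []; rewrite !in_itv/= andbT => /andP[_ xb].
by rewrite ltNge xb.
Qed.

Lemma normal_tail_le a b : a <= b -> normal_tail b <= normal_tail a.
Proof. by move=> ab; rewrite -subr_ge0 normal_tailB// fine_ge0. Qed.

Let half_sqr_exp_le (x y : R) : 0 <= x -> x <= y ->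
  expR (- y ^+ 2 / 2) <= expR (- x ^+ 2 / 2).
Proof.
move=> x0 xy; rewrite ler_expR ler_pM2r// lerN2 ler_sqr// nnegrE//.
exact: le_trans xy.
Qed.

Lemma normal_tail_lt a b : 0 <= a -> a < b -> normal_tail b < normal_tail a.
Proof.
move=> a0 ab; rewrite -subr_gt0 normal_tailB ?ltW//.
have lu x : a <= x <= b -> expR (- b ^+ 2 / 2) <= expR (- x ^+ 2 / 2) <= 1.
  move=> /andP[ax xb]; rewrite half_sqr_exp_le ?(le_trans a0 ax)//=.
  by rewrite -expR0 ler_expR mulNr oppr_le0 divr_ge0 ?sqr_ge0.
have /andP[Nab _] := N_itv_bounds (expR_ge0 _) (ltW ab) lu.
apply: lt_le_trans Nab.
by rewrite mulr_gt0 ?subr_gt0// mulr_gt0// expR_gt0.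
Qed.

Lemma normal_tail_lipschitz a b : a <= b ->
  normal_tail a - normal_tail b <= b - a.
Proof.
move=> ab; rewrite normal_tailB//.
have lu x : a <= x <= b -> 0 <= expR (- x ^+ 2 / 2) <= 1.
  rewrite expR_ge0/= -expR0 ler_expR mulNr oppr_le0 divr_ge0//.
  exact: sqr_ge0.
have /andP[_ Nab] := N_itv_bounds (lexx 0) ab lu.
by rewrite (le_trans Nab)// mulr1 ler_piMl ?subr_ge0.
Qed.

Lemma continuous_normal_tail : continuous (@normal_tail R).
Proof.
have lip (x y : R) : `|normal_tail x - normal_tail y| <= `|x - y|.
  wlog xy : x y / x <= y.
    move=> H; have [xy|/ltW yx] := leP x y; first exact: H.
    by rewrite distrC [leRHS]distrC; exact: H.
  have txy : 0 <= normal_tail x - normal_tail y.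
    by rewrite subr_ge0; exact: normal_tail_le.
  have yx : 0 <= y - x by rewrite subr_ge0.
  rewrite (ger0_norm txy) distrC (ger0_norm yx).
  exact: normal_tail_lipschitz.
move=> x; apply/cvgrPdist_le => e e0; near=> y.
rewrite (le_trans (lip x y))//; near: y.
Unshelve. all: by end_near. Qed.

Let fineNE (D : set R) : measurable D -> fine (N D) =
  peak * fine (\int[lebesgue_measure]_(x in D) (expR (- x ^+ 2 / 2))%:E)%E.
Proof.
move=> mD; have pN0 : peak != 0 by rewrite gt_eqF.
have -> : (\int[lebesgue_measure]_(x in D) (expR (- x ^+ 2 / 2))%:E =
    peak^-1%:E * N D)%E.
  by rewrite NE// muleA -EFinM mulVf// mul1e.
by rewrite fineM ?N_fin// mulrA divff// mul1r.
Qed.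

Let N_left z : fine (N `]-oo, z]%classic) = 1 - normal_tail z.
Proof.
rewrite (_ : `]-oo, z]%classic = ~` `]z, +oo[%classic); last by rewrite setCitvr.
by rewrite probability_setC// fineB// N_fin.
Qed.

Lemma normal_tail_cdf z :
  peak * (\int[lebesgue_measure]_(x in `]-oo, z]) expR (- x ^+ 2 / 2)) =
  1 - normal_tail z.
Proof. by rewrite -N_left fineNE. Qed.

Lemma normal_prob_symmetric z : 0 <= z ->
  fine (N `[- z, z]%classic) = 1 - 2 * normal_tail z.
Proof.
move=> z0.
have left_tail : fine (N `]-oo, (- z)[%classic) = normal_tail z.
  rewrite /normal_tail !fineNE//; congr (_ * fine _).
  rewrite integral_itv_bndo_bndc; last exact: mg.
  rewrite integral_itv_obnd_cbnd; last exact: mg.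
  rewrite ge0_integration_by_substitutionNy.
  - by apply: eq_integral => x _ /=; rewrite sqrrN.
  - by apply: continuous_subspaceT; exact: continuous_half_sqr_exp.
  - by move=> x _; exact: expR_ge0.
have := N_left z; rewrite (@itv_bndbnd_setU _ _ _ (BLeft (- z))) ?bnd_simp//; last lra.
rewrite measureU//; last first.
  apply/seteqP; split => // x /= []; rewrite !in_itv/= => xz /andP[zx _].
  by move: xz; rewrite ltNge zx.
rewrite fineD ?N_fin// left_tail; lra.
Qed.

(** The symmetric window degenerates to a point, of mass 0. *)
Lemma normal_tail0 : normal_tail 0 = 1 / 2 :> R.
Proof.
have := normal_prob_symmetric (lexx 0); rewrite oppr0 set_itv1.
rewrite NE// integral_set1 mule0 /=; lra.
Qed.

(** For [x >= z >= 1] the integrand is at most [x * expR (- x ^+ 2 / 2)], which has an explicit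
    primitive; the factor [peak] is at most 1. *)
Lemma normal_tail_ub z : 1 <= z -> normal_tail z <= expR (- z ^+ 2 / 2).
Proof.
move=> z1; rewrite -lee_fin fineK ?N_fin// NE//.
have dF (t : R) :
    is_derive t 1 (fun y => - expR (- y ^+ 2 / 2)) (t * expR (- t ^+ 2 / 2)).
  by apply: is_derive_eq (is_deriveN (is_derive_half_sqr_exp t)) _; rewrite opprK.
have cf : continuous (fun t : R => t * expR (- t ^+ 2 / 2)).
  by move=> t; apply: cvgM; [exact: cvg_id|exact: continuous_half_sqr_exp].
have lim0 : - expR (- t ^+ 2 / 2) @[t --> +oo] --> (0 : R).
  rewrite -oppr0; apply: cvgN; under eq_fun do rewrite mulNr.
  apply: (cvg_comp (fun t => t ^+ 2 / 2) (fun t => expR (- t))).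
    by apply: gt0_cvgMly => //; exact: cvgr_expr2.
  exact: cvgr_expR.
have pos (t : R) : z <= t -> 0 <= t * expR (- t ^+ 2 / 2).
  by move=> zt; rewrite mulr_ge0 ?expR_ge0// (le_trans _ zt)// (le_trans _ z1).
have := integraly_is_derive dF cf pos lim0; rewrite sub0r opprK => <-.
rewrite integral_itv_obnd_cbnd; last exact: mg.
apply: (@le_trans _ _ (\int[lebesgue_measure]_(x in `[z, +oo[)
    (expR (- x ^+ 2 / 2))%:E)%E).
  rewrite -[leRHS]mul1e lee_wpmul2r//.
  by apply: integral_ge0 => x _; rewrite lee_fin expR_ge0.
apply: ge0_le_integral => //.
- exact: mg.
- by apply/measurable_EFinP; apply: measurable_funTS; exact: continuous_measurable_fun.
- move=> x; rewrite /= in_itv/= andbT => zx; rewrite lee_fin ler_peMl ?expR_ge0//.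
  exact: le_trans zx.
Qed.

(** Keep only the mass of []z, z + 1]], where the density is smallest at the right end. *)
Lemma normal_tail_lb z : 0 <= z ->
  peak * expR (- (z + 1) ^+ 2 / 2) <= normal_tail z.
Proof.
move=> z0; apply: (@le_trans _ _ (normal_tail z - normal_tail (z + 1))); last first.
  by rewrite lerBlDr lerDl fine_ge0.
rewrite normal_tailB ?lerDl//.
have lu x : z <= x <= z + 1 ->
    expR (- (z + 1) ^+ 2 / 2) <= expR (- x ^+ 2 / 2) <= expR (- z ^+ 2 / 2).
  by move=> /andP[zx xz]; rewrite !half_sqr_exp_le// (le_trans z0 zx).
have zz : z <= z + 1 by rewrite lerDl.
have /andP[+ _] := N_itv_bounds (expR_ge0 _) zz lu.
by rewrite [z + 1 - z]addrAC subrr add0r mulr1.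
Qed.

Lemma normal_tail_Z_quantile delta : 0 < delta < 1 ->
  0 < Z_quantile delta /\ normal_tail (Z_quantile delta) = delta / 2.
Proof.
move=> /andP[d0 d1].
have QZ : normal_tail (Z_quantile delta) = delta / 2.
  have [z Qz] : exists z, normal_tail z = delta / 2.
    (* As [b >= 1], [b ^+ 2 / 2 >= b / 2 >= ln (2 / delta)], so the tail at [b] is at most
       [delta / 2], while at 0 it is [1 / 2]. *)
    pose b := 1 + 2 * ln (2 / delta).
    have l0 : 0 <= ln (2 / delta) by rewrite ln_ge0// ler_pdivlMr//; lra.
    have b1 : 1 <= b by rewrite lerDl mulr_ge0.
    have tb : normal_tail b <= delta / 2.
      apply: (le_trans (normal_tail_ub b1)).
      have -> : delta / 2 = expR (- ln (2 / delta)).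
        by rewrite -lnV ?posrE ?divr_gt0// lnK ?invf_div// posrE divr_gt0.
      rewrite ler_expR mulNr lerN2 ler_pdivlMr//.
      have : b * 1 <= b * b by rewrite ler_wpM2l// (le_trans ler01).
      by rewrite /b expr2; lra.
    have b0 : 0 <= b by rewrite (le_trans ler01).
    have [||z _ <-] := @IVT R (@normal_tail R) 0 b (delta / 2) b0; last by exists z.
      exact/continuous_subspaceT/continuous_normal_tail.
    rewrite ge_min le_max tb orbT /= normal_tail0; apply/orP; left; lra.
  have : [set z : R | (Num.sqrt (2 * pi))^-1 *
      (\int[lebesgue_measure]_(x in `]-oo, z]) expR (- x ^+ 2 / 2))
      = 1 - delta / 2] (Z_quantile delta).
    (* Existence of a solution rules out the default value 0. *)
    by apply: xgetPex; exists z; rewrite /= normal_tail_cdf Qz.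
  by rewrite /= normal_tail_cdf; lra.
split=> //; rewrite ltNge; apply/negP => /normal_tail_le.
by rewrite QZ normal_tail0; lra.
Qed.

End normal_tail.

Section quantile_asymptotics.
Context (R : realType).

Let C : R := ln (Num.sqrt (2 * pi)).

Let ln_tail_bounds (delta : R) : 0 < delta < 1 ->
  (1 <= Z_quantile delta -> Z_quantile delta ^+ 2 / 2 <= ln (2 / delta)) /\
  ln (2 / delta) <= (Z_quantile delta + 1) ^+ 2 / 2 + C.
Proof.
move=> d01; have /andP[d0 d1] := d01.
have [Z0 QZ] := normal_tail_Z_quantile d01.
have dE : delta / 2 = expR (- ln (2 / delta)).
  by rewrite -lnV ?posrE ?divr_gt0// lnK ?invf_div// posrE divr_gt0.
split=> [Z1|].
  have := normal_tail_ub Z1.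
  by rewrite QZ dE ler_expR mulNr lerN2.
have := normal_tail_lb (ltW Z0); rewrite QZ dE.
have -> : (Num.sqrt (2 * pi))^-1 = expR (- C).
  by rewrite expRN lnK// posrE sqrtr_gt0 mulr_gt0// pi_gt0.
rewrite -expRD ler_expR mulNr; lra.
Qed.

Let cvg_Z_quantile : Z_quantile delta @[delta --> 0^'+] --> (+oo : set_system R).
Proof.
(* [A] bounds [ln (2 / delta)] whenever [Z_quantile delta < M], which fails for small [delta]. *)
apply/cvgryPge => M; pose A := (`|M| + 1) ^+ 2 / 2 + C.
near=> delta.
have d01 : 0 < delta < 1 by apply/andP; split.
have [_ lnZ] := ln_tail_bounds d01; have [Z0 _] := normal_tail_Z_quantile d01.
have /andP[d0 d1] := d01.
have Ad : A < ln (2 / delta).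
  rewrite -ltr_expR lnK ?posrE ?divr_gt0// ltr_pdivlMr// -ltr_pdivlMl ?expR_gt0//.
  by near: delta; apply: nbhs_right_lt; rewrite mulr_gt0// invr_gt0 expR_gt0.
rewrite leNgt; apply/negP => ZM.
have : (Z_quantile delta + 1) ^+ 2 <= (`|M| + 1) ^+ 2.
  rewrite ler_sqr ?nnegrE ?addr_ge0 ?(ltW Z0)// lerD2r.
  exact/ltW/(lt_le_trans ZM)/ler_norm.
move: Ad lnZ; rewrite /A; lra.
Unshelve. all: by end_near. Qed.

(** With [Z] the quantile, the logarithms of the two tail bounds place the ratio between 1 and
    [(1 + Z^-1) ^+ 2 + 2 * C / Z ^+ 2]. *)
Lemma cvg_ln_Z_quantile :
  2 * ln (2 / delta) / Z_quantile delta ^+ 2 @[delta --> 0^'+] --> (1 : R).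
Proof.
have iZ : (Z_quantile delta)^-1 @[delta --> 0^'+] --> (0 : R).
  apply/gtr0_cvgV0; last exact: cvg_Z_quantile.
  by have /cvgryPgt := cvg_Z_quantile; exact.
have up : (1 + (Z_quantile delta)^-1) ^+ 2 +
    2 * C * ((Z_quantile delta)^-1 * (Z_quantile delta)^-1)
    @[delta --> 0^'+] --> (1 : R).
  have h1 : 1 + (Z_quantile delta)^-1 @[delta --> 0^'+] --> (1 : R).
    by have := cvgD (cvg_cst (1 : R)) iZ; rewrite addr0; exact.
  have := cvgD (cvgM h1 h1) (cvgM (cvg_cst (2 * C)) (cvgM iZ iZ)).
  by rewrite !mulr0 addr0 mulr1; exact.
apply: (squeeze_cvgr _ (cvg_cst (1 : R)) up); near=> delta.
have d01 : 0 < delta < 1 by apply/andP; split.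
have [lnZ1 lnZ2] := ln_tail_bounds d01.
have Z1 : 1 <= Z_quantile delta.
  by near: delta; have /cvgryPge := cvg_Z_quantile; exact.
have Z0 : 0 < Z_quantile delta by exact: lt_le_trans Z1.
have Z20 : 0 < Z_quantile delta ^+ 2 by rewrite exprn_gt0.
apply/andP; split.
  by rewrite ler_pdivlMr// mul1r; have := lnZ1 Z1; lra.
rewrite ler_pdivrMr//.
rewrite (_ : _ * _ ^+ 2 = (Z_quantile delta + 1) ^+ 2 + 2 * C); first lra.
by field; rewrite gt_eqF.
Unshelve. all: by end_near. Qed.

End quantile_asymptotics.

(** * Asymptotics of the minimal sample size *)

Section sample_size.
Context d (T : measurableType d) (R : realType) (P : probability T R).
Variables (mu : R) (X : nat -> {RV P >-> R}).
Hypothesis mu_gt0 : 0 < mu.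
Hypothesis X_indep : mutually_independent X.
Hypothesis X_rayleigh : forall i, has_density (X i) (rayleigh_pdf mu).
Implicit Types (eps delta z v : R) (N : nat).

Let S := partial_sum X (fun x => x ^+ 2 / mu).

Let mS N : measurable_fun setT (S N).
Proof.
by apply: measurable_partial_sum; apply: measurable_funM => //; exact: measurable_funX.
Qed.

Let ok N eps := [set w | `|(mu_hat X N w - mu) / mu| < eps].

Let okE N eps : (0 < N)%N ->
  ok N eps = [set w | N%:R - N%:R * eps < S N w < N%:R + N%:R * eps].
Proof.
move=> N0; have N0' : 0 < N%:R :> R by rewrite ltr0n.
have SE w : (mu_hat X N w - mu) / mu = (S N w - N%:R) / N%:R.
  rewrite /mu_hat /S /partial_sum -mulr_suml; field.
  by rewrite !gt_eqF.
apply/seteqP; split => w; rewrite /ok /= SE ltr_norml ltr_pdivlMr// ltr_pdivrMr//;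
  by move=> /andP[h1 h2]; apply/andP; split; lra.
Qed.

Let mwindow N a b : measurable (S N @^-1` `]a, b]).
Proof. by rewrite -[X in measurable X]setTI; exact: mS. Qed.

Let probability_window N a b : 0 <= a -> a <= b ->
  P (S N @^-1` `]a, b]) = (erlang_tail N a - erlang_tail N b)%:E.
Proof.
move=> a0 ab; have b0 := le_trans a0 ab.
have := rayleigh_sum_tail mu_gt0 X_indep X_rayleigh N a0.
rewrite (@itv_bndbnd_setU _ _ _ (BRight b)) ?bnd_simp// preimage_setU measureU//.
- rewrite [X in (_ + X)%E](rayleigh_sum_tail mu_gt0 X_indep X_rayleigh N b0).
  by rewrite EFinB => <-; rewrite addeK.
- by rewrite -[X in measurable X]setTI; exact: mS.
- apply/seteqP; split => // w /= []; rewrite !in_itv/= andbT => /andP[_ xb].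
  by rewrite ltNge xb.
Qed.

Let mok N eps : (0 < N)%N -> measurable (ok N eps).
Proof.
move=> N0; rewrite okE//.
rewrite (_ : [set w | _] =
    S N @^-1` `](N%:R - N%:R * eps), (N%:R + N%:R * eps)[%classic); last first.
  by apply/seteqP; split => w /=; rewrite in_itv.
by rewrite -[X in measurable X]setTI; exact: mS.
Qed.

Let ok_le N eps a b : (0 < N)%N -> 0 <= a -> a <= b ->
  a <= N%:R - N%:R * eps -> N%:R + N%:R * eps <= b ->
  (P (ok N eps) <= (erlang_tail N a - erlang_tail N b)%:E)%E.
Proof.
move=> N0 a0 ab aN Nb; rewrite -probability_window//.
apply: le_measure; rewrite ?inE//; first exact: mok.
rewrite okE// => w /= /andP[h1 h2]; rewrite in_itv/= (le_lt_trans aN)//=.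
exact/ltW/(lt_le_trans h2).
Qed.

(** The accuracy event is an open window while Erlang tails measure half-open ones; inclusions
    suffice. Here the right inequality is strict because []a, b]] contains [b]. *)
Let ok_ge N eps a b : (0 < N)%N -> 0 <= a -> a <= b ->
  N%:R - N%:R * eps <= a -> b < N%:R + N%:R * eps ->
  ((erlang_tail N a - erlang_tail N b)%:E <= P (ok N eps))%E.
Proof.
move=> N0 a0 ab aN Nb; rewrite -probability_window//.
apply: le_measure; rewrite ?inE//; first exact: mok.
rewrite okE// => w /=; rewrite in_itv/= => /andP[h1 h2].
by rewrite (le_lt_trans aN)//= (le_lt_trans h2).
Qed.

Let window_limit z : 0 < z ->
  erlang_window N z @[N --> \oo] --> 1 - 2 * normal_tail z.
Proof.
move=> z0; rewrite -normal_prob_symmetric ?ltW//.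
by rewrite -(cvg_shiftn 2); under eq_fun do rewrite addn2; exact: cvg_erlang_window.
Qed.

Let sqrt_mulr_nat v N : 0 <= v -> v <= N%:R ->
  0 <= N%:R - Num.sqrt v * Num.sqrt N%:R.
Proof.
move=> v0 vN; rewrite subr_ge0 -[leRHS]sqr_sqrtr// expr2.
by rewrite ler_wpM2r// ler_wsqrtr.
Qed.

(** Since [(N * eps) ^ 2 = N * (eps ^ 2 * N)], comparing [eps ^+ 2 * N] with [v] amounts to
    comparing half-widths of windows. *)
Let sqrt_mulr_ge v N eps : 0 <= v -> 0 <= eps -> eps ^+ 2 * N%:R <= v ->
  N%:R * eps <= Num.sqrt v * Num.sqrt N%:R.
Proof.
move=> v0 e0 eN; rewrite -[X in X * eps <= _]sqr_sqrtr// expr2 -mulrA [leRHS]mulrC.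
rewrite ler_wpM2l// -ler_sqr ?nnegrE ?mulr_ge0// exprMn !sqr_sqrtr//.
by rewrite mulrC.
Qed.

Let sqrt_mulr_lt v N eps : 0 < v -> 0 <= eps -> v < eps ^+ 2 * N%:R ->
  Num.sqrt v * Num.sqrt N%:R < N%:R * eps.
Proof.
move=> v0 e0 eN; have N0 : 0 < N%:R :> R.
  rewrite lt_neqAle ler0n andbT eq_sym; apply/eqP => N0.
  by move: eN; rewrite N0 mulr0; apply/negP; rewrite -leNgt ltW.
rewrite -[X in _ < X * eps]sqr_sqrtr// expr2 -mulrA mulrC.
rewrite ltr_pM2l ?sqrtr_gt0// -ltr_sqr ?nnegrE ?mulr_ge0// exprMn !sqr_sqrtr//.
  by rewrite mulrC.
exact: ltW.
Qed.

Let admissible_lower delta v : 0 < delta < 1 -> 0 < v -> v < Z_quantile delta ^+ 2 ->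
  \forall eps \near 0^'+, forall N, admissible_size X mu eps delta N ->
    v <= eps ^+ 2 * N%:R.
Proof.
move=> d01 v0 vZ; have /andP[d0 d1] := d01.
have [Z0 QZ] := normal_tail_Z_quantile d01.
pose z := Num.sqrt v; have z0 : 0 < z by rewrite sqrtr_gt0.
have zZ : z < Z_quantile delta.
  by rewrite -ltr_sqr ?nnegrE ?ltW// sqr_sqrtr// ltW.
have lim_lt : 1 - 2 * normal_tail z < 1 - delta.
  by have := normal_tail_lt (ltW z0) zZ; rewrite QZ; lra.
(* [v <= N%:R] keeps the left endpoint of the window nonnegative. *)
have [K _ HK] : \forall N \near \oo, erlang_window N z < 1 - delta /\ v <= N%:R.
  near=> N; split; near: N; last exact: nbhs_infty_ger.
  exact: (cvgr_lt _ (window_limit z0)).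
near=> eps => N [N0 HN].
have e0 : 0 < eps by [].
have e1 : eps < 1 by near: eps; exact: nbhs_right_lt.
rewrite leNgt; apply/negP => eN.
have N0' : 0 < N%:R :> R by rewrite ltr0n.
suff : (P (ok N eps) < (1 - delta)%:E)%E by rewrite ltNge HN.
have [NK|KN] := leqP K N.
  have [win vN] := HK N NK.
  have wide := sqrt_mulr_ge (ltW v0) (ltW e0) (ltW eN).
  have zN := mulr_ge0 (ltW z0) (sqrtr_ge0 (N%:R : R)).
  have win_le : (P (ok N eps) <= (erlang_window N z)%:E)%E.
    apply: ok_le => //; [exact: sqrt_mulr_nat (ltW v0) vN|lra| |];
      by move: wide; rewrite -/z; lra.
  by apply: le_lt_trans win_le _; rewrite lte_fin.
have Ne : N%:R * eps <= N%:R by rewrite ler_piMr ?ltW.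
have Ne0 : 0 <= N%:R * eps by rewrite mulr_ge0 ?ltW.
have a0 : 0 <= N%:R - N%:R * eps by rewrite subr_ge0.
have ab : N%:R - N%:R * eps <= N%:R + N%:R * eps by lra.
apply: le_lt_trans (ok_le N0 a0 ab (lexx _) (lexx _)) _.
rewrite lte_fin.
apply: le_lt_trans (ler_erlang_tail _ a0 ab) _.
(* For [N < K] the window has length [2 * N * eps], which bounds its probability; [K.+1] keeps the
   divisor positive. *)
have eK : eps * (2 * K.+1%:R) < 1 - delta.
  rewrite -ltr_pdivlMr ?mulr_gt0//; near: eps; apply: nbhs_right_lt.
  by rewrite divr_gt0 ?mulr_gt0// subr_gt0.
have : N%:R * eps <= K.+1%:R * eps by rewrite ler_wpM2r ?ltW// ltr_nat ltnS ltnW.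
by lra.
Unshelve. all: by end_near. Qed.

Let admissible_upper delta v : 0 < delta < 1 -> Z_quantile delta ^+ 2 < v ->
  \forall eps \near 0^'+, exists2 N, admissible_size X mu eps delta N &
    eps ^+ 2 * N%:R <= v + eps ^+ 2.
Proof.
move=> d01 vZ; have /andP[d0 d1] := d01.
have [Z0 QZ] := normal_tail_Z_quantile d01.
have v0 : 0 < v by exact: le_lt_trans (sqr_ge0 _) vZ.
pose z := Num.sqrt v; have z0 : 0 < z by rewrite sqrtr_gt0.
have zZ : Z_quantile delta < z.
  by rewrite -ltr_sqr ?nnegrE ?ltW// sqr_sqrtr// ltW.
have lim_gt : 1 - delta < 1 - 2 * normal_tail z.
  by have := normal_tail_lt (ltW Z0) zZ; rewrite QZ; lra.
have [K _ HK] : \forall N \near \oo, 1 - delta < erlang_window N z /\ v <= N%:R.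
  near=> N; split; near: N; last exact: nbhs_infty_ger.
  exact: (cvgr_gt _ (window_limit z0)).
near=> eps.
have e0 : 0 < eps by [].
have e1 : eps < 1 by near: eps; exact: nbhs_right_lt.
have e20 : 0 < eps ^+ 2 by rewrite exprn_gt0.
(* The least [N] with [v < eps ^+ 2 * N]; rounding overshoots [v] by at most [eps ^+ 2]. *)
pose N := (Num.truncn (v / eps ^+ 2)).+1.
have ve0 : 0 <= v / eps ^+ 2 by rewrite divr_ge0 ?ltW.
have vN : v < eps ^+ 2 * N%:R.
  by rewrite mulrC -ltr_pdivrMr// /N truncnS_gt.
have Nv : eps ^+ 2 * N%:R <= v + eps ^+ 2.
  rewrite /N -natr1 mulrDr mulr1 lerD2r mulrC -ler_pdivlMr//.
  by rewrite truncn_le.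
have NK : (K <= N)%N.
  rewrite -(ler_nat R); apply: (@le_trans _ _ (v / eps ^+ 2)); last first.
    by rewrite /N ltW// truncnS_gt.
  rewrite ler_pdivlMr//.
  have eK : eps * K.+1%:R < v.
    by rewrite -ltr_pdivlMr//; near: eps; apply: nbhs_right_lt; rewrite divr_gt0.
  have : eps ^+ 2 * K%:R <= eps * K.+1%:R.
    apply: ler_pM => //; [exact: ltW| |by rewrite ler_nat].
    by rewrite expr2 ler_piMr// ltW.
  by lra.
exists N => //; split=> //.
have [win vN'] := HK N NK.
have zN := mulr_ge0 (ltW z0) (sqrtr_ge0 (N%:R : R)).
have wide := sqrt_mulr_lt v0 (ltW e0) vN; rewrite -/z in wide.
apply: (@le_trans _ _ (erlang_window N z)%:E); first by rewrite lee_fin ltW.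
apply: ok_ge => //; [exact: sqrt_mulr_nat (ltW v0) vN'|lra|lra|lra].
Unshelve. all: by end_near. Qed.

Let N_under_min delta eps N : admissible_size X mu eps delta N ->
  is_min_nat (admissible_size X mu eps delta) (N_under X mu eps delta).
Proof.
move=> aN; apply: xgetPex.
have exA : exists n, `[< admissible_size X mu eps delta n >].
  by exists N; exact/asboolP.
case: (ex_minnP exA) => m /asboolP am minm; exists m; split => // k ak.
by apply: minm; exact/asboolP.
Qed.

Lemma cvg_N_under delta : 0 < delta < 1 ->
  eps ^+ 2 * (N_under X mu eps delta)%:R @[eps --> 0^'+] -->
  Z_quantile delta ^+ 2.
Proof.
move=> d01; have [Z0 QZ] := normal_tail_Z_quantile d01.
have Z20 : 0 < Z_quantile delta ^+ 2 by rewrite exprn_gt0.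
apply/cvgrPdist_le => e e0.
(* The second argument keeps [v] positive when [e] is large. *)
pose v := Num.max (Z_quantile delta ^+ 2 - e) (Z_quantile delta ^+ 2 / 2).
have v0 : 0 < v by rewrite lt_max divr_gt0 ?orbT.
have vZ : v < Z_quantile delta ^+ 2 by rewrite gt_max; apply/andP; split; lra.
(* The other half of [e] is reserved for the rounding error [eps ^+ 2]. *)
have Zv : Z_quantile delta ^+ 2 < Z_quantile delta ^+ 2 + e / 2 by lra.
have Nlow := admissible_lower d01 v0 vZ.
have Nup := admissible_upper d01 Zv.
near=> eps.
have ep0 : 0 < eps by [].
have ee : eps ^+ 2 <= e / 2.
  have e1 : eps <= 1 by near: eps; exact: nbhs_right_le.
  have ee : eps <= e / 2 by near: eps; apply: nbhs_right_le; rewrite divr_gt0.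
  by apply: le_trans ee; rewrite expr2 ler_piMr// ltW.
have low : forall N, admissible_size X mu eps delta N -> v <= eps ^+ 2 * N%:R.
  by near: eps.
have [N aN Nle] : exists2 N, admissible_size X mu eps delta N &
    eps ^+ 2 * N%:R <= Z_quantile delta ^+ 2 + e / 2 + eps ^+ 2.
  by near: eps.
have [aM minM] := N_under_min aN.
have MN : eps ^+ 2 * (N_under X mu eps delta)%:R <= eps ^+ 2 * N%:R.
  by rewrite ler_wpM2l ?sqr_ge0// ler_nat minM.
have vM := low _ aM.
have ve : Z_quantile delta ^+ 2 - e <= v by rewrite le_max lexx.
by rewrite ler_norml; apply/andP; split; lra.
Unshelve. all: by end_near. Qed.

(** The factor [eps ^+ 2] in the denominator of [N_over] is grouped with [N_under], and
    [3 + 2 * eps] tends to 3. *)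
Lemma cvg_N_over_N_under delta : 0 < delta < 1 ->
  N_over eps delta / (N_under X mu eps delta)%:R @[eps --> 0^'+] -->
  2 * ln (2 / delta) / Z_quantile delta ^+ 2.
Proof.
move=> d01; have [Z0 _] := normal_tail_Z_quantile d01.
have num : 2 * (3 + 2 * eps) * ln (2 / delta) / 3 @[eps --> 0^'+] -->
    2 * ln (2 / delta).
  have id0 : eps @[eps --> (0 : R)^'+] --> (0 : R).
    exact: cvg_at_right_filter cvg_id.
  have -> : 2 * ln (2 / delta) = 2 * (3 + 2 * 0) * ln (2 / delta) / 3 by field.
  apply: cvgMr_tmp; apply: cvgMr_tmp; apply: cvgMl_tmp.
  by apply: cvgD; [exact: cvg_cst|apply: cvgMl_tmp; exact: id0].
have den : (eps ^+ 2 * (N_under X mu eps delta)%:R)^-1 @[eps --> 0^'+] -->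
    (Z_quantile delta ^+ 2)^-1.
  by apply: cvgV; [rewrite gt_eqF// exprn_gt0|exact: cvg_N_under].
apply: cvg_trans (cvgM num den); apply: near_eq_cvg; near=> eps.
by rewrite /N_over /= !invfM; ring.
Unshelve. all: by end_near. Qed.

End sample_size.

(** As [lim] is a total operator, the existence of the inner limit is a separate conjunct. Near 0
    every [delta] lies in []0, 1[], where the inner limit has the closed form of the last
    conjunct. *)
Theorem theorem2 (R : realType) (d : measure_display) (T : measurableType d)
    (P : probability T R) (mu : R) (X : nat -> {RV P >-> R})
    (mu_gt0 : 0 < mu)
    (X_indep : mutually_independent X)
    (X_rayleigh : forall i, has_density (X i) (rayleigh_pdf mu)) :
  (forall delta : R, 0 < delta < 1 ->
    cvg (N_over eps delta / (N_under X mu eps delta)%:R @[eps --> 0^'+])) /\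
  (lim (N_over eps delta / (N_under X mu eps delta)%:R @[eps --> 0^'+])
     @[delta --> 0^'+] --> (1 : R)) /\
  (2 * ln (2 / delta) / Z_quantile delta ^+ 2 @[delta --> 0^'+] --> (1 : R)).
Proof.
have ratio := cvg_N_over_N_under mu_gt0 X_indep X_rayleigh.
split; first by move=> delta /ratio; exact: cvgP.
split; last exact: cvg_ln_Z_quantile.
apply: cvg_trans (@cvg_ln_Z_quantile R); apply: near_eq_cvg; near=> delta.
have d01 : 0 < delta < 1 by apply/andP; split.
by apply/esym/cvg_lim => //; exact: ratio.
Unshelve. all: by end_near. Qed.
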